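(* Let $n\ge 1$, $a=(a_1,\dots,a_n)\in\mathbb{R}_{>0}^n$ and $z\in\mathcal{W}_0^n$. Suppose the process $\mathbf{Z}=(\mathbf{Z}(t);t\ge 0)$ on $\mathbb{K}_0^{2n}$ has initial distribution $M_a^n(\cdot;z)$ and evolves according to Berele's dynamics. Then $(Z^{2n}(t);t\ge 0)$ is distributed as a (continuous-time Markov) process on $\mathcal{W}_0^n$ with transition rate matrix $Q_n$, started from $z$. Moreover, for each $t>0$, the conditional law of $\mathbf{Z}(t)$ given $\{Z^{2n}(s),s\le t\}$ is $M_a^n(\cdot;Z^{2n}(t))$.
   Context: **Patterns.** $\mathcal{W}_0^n=\{z\in\mathbb{Z}^n: z_1\ge\dots\ge z_n\ge 0\}$. $\mathbb{K}_0^{2n}$ is the set of symplectic Gelfand–Tsetlin patterns $\mathbf z=(z^1,\dots,z^{2n})$ with $z^{2l-1},z^{2l}\in\mathbb{Z}_{\ge0}^l$ for $1\le l\le n$, satisfying the interlacing conditions $z^{2l}_{i+1}\le z^{2l-1}_i\le z^{2l}_i$ for $1\le i\le l$ (with $z^{2l}_{l+1}:=0$) and $z^{2l+1}_{i+1}\le z^{2l}_i\le z^{2l+1}_i$ for $1\le i\le l$. Write $|z|=\sum_i z_i$, $|z^0|=0$, and $\mathbb{K}_0^{2n}[z]=\{\mathbf z\in\mathbb{K}_0^{2n}: z^{2n}=z\}$. **Weights.** $w^a_{2n}(\mathbf z)=\prod_{i=1}^n a_i^{2|z^{2i-1}|-|z^{2i}|-|z^{2i-2}|}$; the symplectic Schur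 function is $Sp^{(n)}_z(a)=\sum_{\mathbf z\in\mathbb{K}_0^{2n}[z]}w^a_{2n}(\mathbf z)$; and $M^n_a(\mathbf z;z)=w^a_{2n}(\mathbf z)/Sp_z^{(n)}(a)$ for $\mathbf z\in\mathbb{K}_0^{2n}[z]$, a probability distribution on $\mathbb{K}_0^{2n}[z]$. **Rate matrix.** With $e_1,\dots,e_n$ the standard basis, for $z\in\mathcal W_0^n$ and $z\pm e_i\in\mathcal W_0^n$, $Q_n(z,z\pm e_i)=Sp^{(n)}_{z\pm e_i}(a)/Sp^{(n)}_z(a)$; all other off-diagonal entries are $0$; $Q_n(z,z)=-\sum_{i=1}^n(a_i+a_i^{-1})$. **Berele's dynamics.** $\mathbf Z$ is a continuous-time Markov process on $\mathbb{K}^{2n}_0$; $Z^k_i$ denotes the $i$-th particle of level $k$, $1\le i\le[\frac{k+1}{2}]$, $1\le k\le 2n$. Only the right-edge particles $Z^k_1$ attempt jumps of their own volition, always one step to the right, with independent exponential clocks: $Z^{2l-1}_1$ at rate $a_l$ and $Z^{2l}_1$ at rate $a_l^{-1}$ ($1\le l\le n$). Every attempted move propagates instantaneously to the bottom level by the following rules, where all comparisons are made in the configuration at time $T-$ just before the jump time $T$. Rightward attempt by $Z^k_i$, $k<2n$ (whether of its own volition or triggered from the level above): (i) if $Z^k_i(T-)=Z^{k+1}_i(T-)$, then $Z^k_i$ jumps one step right and triggers a rightward attempt of $Z^{k+1}_i$; (ii) if $Z^k_i(T-)<Z^{k+1}_i(T-)$: (a) if $k$ is odd and $i=\frac{k+1}{2}$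 (including $k=1$), the jump of $Z^k_i$ is suppressed and $Z^{k+1}_i$ performs a left jump instead; (b) otherwise $Z^k_i$ jumps one step right and triggers a rightward attempt of $Z^{k+1}_{i+1}$. A rightward attempt at level $k=2n$ is simply performed. Left jump of $Z^k_i$, $k<2n$: it triggers a left jump (one step) of exactly one particle of level $k+1$: of $Z^{k+1}_{i+1}$ if that particle exists and $Z^k_i(T-)=Z^{k+1}_{i+1}(T-)$, and of $Z^{k+1}_i$ otherwise. At $k=2n$ the procedure ends. *)

(* Defs.v *)
From HB Require Import structures.
From mathcomp Require Import all_boot all_order all_algebra.
From mathcomp Require Import all_classical all_reals all_analysis.
Set Implicit Arguments.
Unset Strict Implicit.
Unset Printing Implicit Defensive.
Import Order.TTheory GRing.Theory Num.Theory.
Import numFieldNormedType.Exports.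
Local Open Scope classical_set_scope.
Local Open Scope ring_scope.

(** * Symplectic Gelfand-Tsetlin patterns

    A configuration is the list [:: z^1; ...; z^2n] of its levels.  Levels are
    numbered from 1 as usual, with z^0 the empty level; particles inside a
    level are numbered from 0, so Z^k_i is [nth 0 (level z k) i.-1].  Reading
    past the end of a level gives 0, in accordance with the convention
    z^{2l}_{l+1} = 0. *)

Definition level (z : seq (seq nat)) (k : nat) : seq nat :=
  nth [::] ([::] :: z) k.

Definition interlaced (x y : seq nat) : bool :=
  all (fun i => nth 0 y i.+1 <= nth 0 x i <= nth 0 y i)%N (iota 0 (size x)).

Definition is_pattern (n : nat) (z : seq (seq nat)) : bool :=
  (shape z == [seq k.+1./2 | k <- iota 1 n.*2]) && sorted interlaced z.

Definition pattern (n : nat) : Type := {z : seq (seq nat) | is_pattern n z}.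

Definition is_weyl (n : nat) (z : seq nat) : bool :=
  (size z == n) && sorted geq z.

Definition weyl (n : nat) : Type := {z : seq nat | is_weyl n z}.

Lemma interlaced_sorted (x y : seq nat) :
  ((size y).-1 <= size x)%N -> interlaced x y -> sorted geq y.
Proof.
move=> sxy /allP xy; apply/(sortedP 0%N) => i iy /=.
have ix : (i < size x)%N by apply: leq_trans sxy; rewrite -ltnS prednK //; case: y iy {xy}.
have := xy i; rewrite mem_iota add0n ix => /(_ isT) /andP[h1 h2].
exact: leq_trans h1 h2.
Qed.

Lemma bottom_row_subproof (n : nat) (x : pattern n) :
  is_weyl n (level (val x) n.*2).
Proof.
case: x => z /= /andP[/eqP shz /(sortedP [::]) zz].
have szz : size z = n.*2 by rewrite -(size_map size) -/(shape z) shz size_map size_iota.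
case: n => [|m] in shz szz *; first by [].
have szl k : (k < m.+1.*2)%N -> size (nth [::] z k) = k.+2./2.
  move=> km; rewrite -(nth_map [::] 0%N size) ?szz // -/(shape z) shz.
  by rewrite (nth_map 0%N) ?size_iota // nth_iota.
rewrite /is_weyl /level /= szl // -[m.*2.+3]/(m.+1.*2.+1) /= uphalf_double eqxx /=.
apply: (@interlaced_sorted (nth [::] z m.*2)); last by apply: zz; rewrite szz.
rewrite !szl //.
by rewrite -[m.*2.+3]/(m.+1.*2.+1) -[m.*2.+2]/(m.+1.*2) /= uphalf_double doubleK.
Qed.

Definition bottom_row (n : nat) (x : pattern n) : weyl n :=
  exist _ (level (val x) n.*2) (bottom_row_subproof x).

(** * Weights and symplectic Schur functions *)

Section Weights.
Variables (R : realType) (n : nat) (a : 'I_n -> R).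

(* [i] is 0-based: the exponent of a_{i+1} involves the levels 2i+1, 2i+2, 2i. *)
Definition weight (x : pattern n) : R :=
  let s k := (sumn (level (val x) k))%:Z in
  \prod_(i < n) a i ^ (2 * s i.*2.+1 - s i.*2.+2 - s i.*2).

(* The index set is finite: every entry of [x] is at most the first entry
   of its bottom row. *)
Definition symplectic_schur (z : weyl n) : R :=
  \sum_(x \in [set x : pattern n | bottom_row x = z]) weight x.

Definition gibbs (x : pattern n) (z : weyl n) : R :=
  if bottom_row x == z then weight x / symplectic_schur z else 0.

(* y = z + e_i for some i; [weyl_succ y z] says that y = z - e_i for some i. *)
Definition weyl_succ (z y : weyl n) : bool :=
  [exists i : 'I_n, val y == incr_nth (val z) i].

Definition weyl_rate (z y : weyl n) : R :=
  if y == z then - \sum_(i < n) (a i + (a i)^-1)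
  else if weyl_succ z y || weyl_succ y z
       then symplectic_schur y / symplectic_schur z
  else 0.

End Weights.

(** * Berele's dynamics

    The functions below receive a level [cur] of the configuration before the
    jump together with the list [below] of the levels k+1, ..., 2n under it, and
    return the updated levels.  The recursive calls are made on the levels
    before the jump, so every comparison takes place at time T-. *)

(* Truncation of [.-1] is harmless: along a pattern, a particle that is asked
   to jump left is at a positive position. *)
Definition decr_nth (s : seq nat) (i : nat) : seq nat :=
  set_nth 0%N s i (nth 0%N s i).-1.

Fixpoint left_jump (i : nat) (cur : seq nat) (below : seq (seq nat)) :
    seq (seq nat) :=
  decr_nth cur i ::
  match below with
  | [::] => [::]
  | next :: below' =>
      if (i.+1 < size next)%N && (nth 0%N cur i == nth 0%N next i.+1)
      then left_jump i.+1 next below'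
      else left_jump i next below'
  end.

(* [k] is the number of the level [cur]; as [i] is 0-based, the test
   [i.+1 == k.+1./2] singles out the particle Z^k_{(k+1)/2}. *)
Fixpoint right_attempt (k i : nat) (cur : seq nat) (below : seq (seq nat)) :
    seq (seq nat) :=
  match below with
  | [::] => [:: incr_nth cur i]
  | next :: below' =>
      if nth 0%N cur i == nth 0%N next i
      then incr_nth cur i :: right_attempt k.+1 i next below'
      else if odd k && (i.+1 == k.+1./2)
      then cur :: left_jump i next below'
      else incr_nth cur i :: right_attempt k.+1 i.+1 next below'
  end.

(* Outcome of a ring of the clock of Z^k_1, k >= 1. *)
Definition clock_ring (k : nat) (z : seq (seq nat)) : seq (seq nat) :=
  take k.-1 z ++ right_attempt k 0 (level z k) (drop k z).

(* Superposition of the 2n independent exponential clocks: a clock of rate r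
   that turns x into x' contributes r to the entry (x, x') and -r to (x, x). *)
Definition berele_rate (R : realType) (n : nat) (a : 'I_n -> R)
    (x y : pattern n) : R :=
  let jump k : R := (val y == clock_ring k (val x))%:R - (y == x)%:R in
  \sum_(l < n) (a l * jump l.*2.+1 + (a l)^-1 * jump l.*2.+2).

(** * Continuous-time Markov chains on a countable state space *)

Section MarkovChain.
Variables (R : realType) (S : countType).

Record transition_function (p : R -> S -> S -> R) : Prop := TransitionFunction {
  transition_ge0 : forall (t : R) x y, 0 <= t -> 0 <= p t x y ;
  transition_sum1 : forall (t : R) x, 0 <= t ->
    (\esum_(y in [set: S]) (p t x y)%:E = 1)%E ;
  transition_0 : forall x y, p 0 x y = (x == y)%:R ;
  transition_semigroup : forall (s t : R) x y, 0 <= s -> 0 <= t ->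
    ((p (s + t) x y)%:E = \esum_(u in [set: S]) (p s x u * p t u y)%:E)%E }.

(* q is the matrix of right derivatives at time 0.  When q is conservative with
   a bounded diagonal, as are [berele_rate] and [weyl_rate], it determines p. *)
Definition has_rate_matrix (p : R -> S -> S -> R) (q : S -> S -> R) : Prop :=
  forall x y, (p h x y - (x == y)%:R) / h @[h --> 0^'+] --> q x y.

Context {d : measure_display} {T : measurableType d}.
Variable P : probability T R.

(* S carries the discrete sigma-algebra; only the times t >= 0 matter. *)
Record markov_process (X : R -> T -> S) (mu : S -> R) (q : S -> S -> R) : Prop :=
  MarkovProcess {
  markov_measurable : forall (t : R) x, 0 <= t -> measurable [set w | X t w = x] ;
  markov_right_continuous : {ae P, forall w, forall t : R, 0 <= t ->
    \forall s \near t^'+, X s w = X t w} ;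
  markov_law : exists p, [/\ transition_function p, has_rate_matrix p q &
    forall (m : nat) (t : nat -> R) (x : nat -> S),
      t 0%N = 0 -> (forall i, (i < m)%N -> t i <= t i.+1) ->
      P [set w | forall i, (i <= m)%N -> X (t i) w = x i] =
      (mu (x 0%N) *
       \prod_(i < m) p (t i.+1 - t i) (x i) (x i.+1))%:E] }.

(* sigma(X s, s <= t) *)
Definition past (X : R -> T -> S) (t : R) : set (set T) :=
  <<s [set A | exists (s : R) x, [/\ 0 <= s, s <= t & A = [set w | X s w = x]]] >>.

(* The conditional law of Y given the sub-sigma-algebra F has probability mass
   function nu w, i.e. P(Y = y | F) = nu w y almost surely, for every y. *)
Definition conditional_law (F : set (set T)) (Y : T -> S) (nu : T -> S -> R) :
    Prop :=
  forall y,
    (forall B, measurable B -> F ((nu ^~ y) @^-1` B)) /\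
    (forall A, F A ->
      (\int[P]_(w in A) (nu w y)%:E = P (A `&` [set w | Y w = y]))%E).

End MarkovChain.

(* Main.v *)
Require Import Defs.
From HB Require Import structures.
From mathcomp Require Import all_boot all_order all_algebra.
From mathcomp Require Import all_classical all_reals all_analysis.
From mathcomp Require Import ring lra zify.
Set Implicit Arguments.
Unset Strict Implicit.
Unset Printing Implicit Defensive.
Import Order.TTheory GRing.Theory Num.Theory.
Import numFieldNormedType.Exports.
Local Open Scope classical_set_scope.
Local Open Scope ring_scope.

(** Write M for the kernel that sends a bottom row z to the Gibbs law
    [gibbs a ^~ z], q for the rate matrix of Berele's dynamics on patterns and Q
    for [weyl_rate].  The theorem follows, as in the Rogers-Pitman criterion for
    functions of Markov processes, from the intertwining relation M q = Q M.  If
    p is the semigroup of q, and pbar_t(z, y) is the probability that the bottom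
    row is y at time t when the pattern starts from M(z, .), the relation passes
    to M p_t = pbar_t M ([intertwining]).  Hence pbar is a semigroup with rate
    matrix Q, and observing the bottom row at successive times never disturbs
    the Gibbs law of the pattern above it ([mixed_path_law]): the bottom row is
    Markov, and conditionally on its past the pattern has law M.  The
    statement about the past is first proved for finitely many observation
    times and then extended by a pi-lambda argument ([past_law]).

    The relation M q = Q M is combinatorial and has two ingredients.  A ring of
    a clock of rate r multiplies the weight of the pattern by r
    ([weight_clock_step]).  And the map sending a pattern with bottom row z,
    together with the clock that rings, to the resulting pattern is a bijection
    onto the patterns whose bottom row differs from z by one unit in one
    coordinate ([clock_step_inj], [clock_step_onto]): this is the reversibility
    of Berele insertion.  To undo a cascade, one reads the new pattern from the
    bottom up: the jump made by a row, together with that row and the new rows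
    above it, determines the jump made by the row above ([unring]).  Summing over the
    bijection gives M q = Q M, in the form of [weighted_sum_generator].

    The hypothesis on p is only that its matrix of right derivatives at 0 is q.
    To transfer the intertwining from q to p, p is recovered by uniformization.
    Let c be the total rate and L = q + c I, a matrix with nonnegative entries
    and row sums c.  The matrices G_t = exp(c t) p_t form a semigroup and
    dominate I + t L ([transition_lower]), hence also (I + (t/N) L)^N.  The
    row sums of these two are exp(c t) and (1 + c t / N)^N, which become equal
    as N grows, so that (I + (t/N) L)^N tends to G_t ([euler_cvg_transition]).
    The Euler products inherit the intertwining relation from L
    ([weighted_sum_euler]), and the limit gives it for p_t. *)

(** * Patterns read from the bottom up *)

Section Combinatorics.
Local Open Scope nat_scope.

(** Rows are listed from the bottom because a cascade, and its reversal, is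
    analysed by removing the last row.  [size y = (size U).+2./2] is the number
    of particles of level [(size U).+1]. *)
Fixpoint rev_pattern (X : seq (seq nat)) : bool :=
  if X is y :: U
  then [&& size y == (size U).+2./2, interlaced (head [::] U) y & rev_pattern U]
  else true.

(** Since a row reads as 0 past its end, the sizes of the rows make the
    interlacing inequalities true at every index, also when [U] is empty. *)
Lemma rev_pattern_consP (y : seq nat) (U : seq (seq nat)) :
  reflect [/\ size y = (size U).+2./2,
              forall i, nth 0 y i.+1 <= nth 0 (head [::] U) i <= nth 0 y i
            & rev_pattern U]
          (rev_pattern (y :: U)).
Proof.
apply: (iffP and3P) => -[].
  move=> /eqP sy /allP uy pU; split=> // i.
  have [iu|ui] := ltnP i (size (head [::] U)); first by apply: uy; rewrite mem_iota.
  rewrite (nth_default _ ui) andbT leqn0; apply/eqP/nth_default.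
  rewrite sy; case: U pU ui {sy uy} => //= u U /andP[/eqP su _]; rewrite su; lia.
move=> /eqP sy uy pU; split=> //; apply/allP => i _; exact: uy.
Qed.

Arguments rev_pattern : simpl never.

(** Pattern hypotheses would enter linear arithmetic as boolean unknowns; only
    the inequalities extracted from them matter. *)
Ltac row_lia :=
  repeat match goal with H : context [rev_pattern _] |- _ => clear H end; lia.

Lemma rev_pattern_weyl (X : seq (seq nat)) i :
  rev_pattern X -> nth 0 (head [::] X) i.+1 <= nth 0 (head [::] X) i.
Proof.
case: X => [|y U]; first by rewrite !nth_nil.
by case/rev_pattern_consP => _ /(_ i) /andP[+ +] _; apply: leq_trans.
Qed.

(** * Cascades and their reversal *)

(** The jump that a cascade imposes on one row, with the index of the particle. *)
Variant move := Right of nat | Left of nat.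

Definition apply_move (m : move) : seq nat -> seq nat :=
  match m with Right i => incr_nth^~ i | Left i => decr_nth^~ i end.

Definition can_move (m : move) (y : seq nat) : bool :=
  if m is Left i then 0 < nth 0 y i else true.

Lemma size_decr_nth s i : i < size s -> size (decr_nth s i) = size s.
Proof. by move=> si; rewrite size_set_nth; apply/maxn_idPr. Qed.

Lemma nth_decr_nth s i j : nth 0 (decr_nth s i) j = nth 0 s j - (i == j).
Proof.
by rewrite nth_set_nth /= eq_sym; case: eqP => [->|_]; rewrite (subn1, subn0).
Qed.

Lemma size_incr_nth_lt s i : i < size s -> size (incr_nth s i) = size s.
Proof. by rewrite size_incr_nth => ->. Qed.

Lemma incr_nthK s i : i < size s -> decr_nth (incr_nth s i) i = s.
Proof.
move=> si; apply: (@eq_from_nth _ 0) => [|j _].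
  by rewrite size_decr_nth size_incr_nth_lt.
by rewrite nth_decr_nth nth_incr_nth addKn.
Qed.

Lemma decr_nthK s i : 0 < nth 0 s i -> incr_nth (decr_nth s i) i = s.
Proof.
move=> si; have ss : i < size s.
  by rewrite ltnNge; apply: contraTN si => /(nth_default 0) ->.
apply: (@eq_from_nth _ 0) => [|j _].
  by rewrite size_incr_nth_lt size_decr_nth.
rewrite nth_incr_nth nth_decr_nth; case: (i =P j) => [<-|] /=; row_lia.
Qed.

(** The particle of the row [z] that is pulled left by particle [i] of the row
    [u] above it. *)
Definition left_child (u z : seq nat) (i : nat) : nat :=
  if (i.+1 < size z) && (nth 0 u i == nth 0 z i.+1) then i.+1 else i.

(** The cascade started by the clock of level [j].  It returns the new rows and
    the jump of the bottom row, the only thing the next level has to know.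
    Whether the jump of the last particle of an odd row is suppressed depends
    on the row below, so that jump is performed first and, in case of
    suppression, undone by [u :: behead V]. *)
Fixpoint rev_ring (j : nat) (X : seq (seq nat)) : move * seq (seq nat) :=
  if X is z :: U then
    if j == size X then (Right 0, incr_nth z 0 :: U) else
    let: (m, V) := rev_ring j U in
    let u := head [::] U in
    match m with
    | Right i =>
        if nth 0 u i == nth 0 z i then (Right i, incr_nth z i :: V)
        else if odd (size U) && (i.+1 == (size U).+1./2)
        then (Left i, decr_nth z i :: u :: behead V)
        else (Right i.+1, incr_nth z i.+1 :: V)
    | Left i =>
        let i' := left_child u z i in (Left i', decr_nth z i' :: V)
    end
  else (Right 0, [::]).

(** The jumps that can have led to the rows [V].  The inequalities say that
    undoing the jump of the bottom row leaves it weakly decreasing.  In addition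
    the last particle of an odd row moves left only when it is pulled by the
    last particle of the row above, and then both arrive at the same position;
    a suppressed jump, on the other hand, acts on the even row below. *)
Definition admissible (m : move) (V : seq (seq nat)) : Prop :=
  let y := head [::] V in
  match m with
  | Right i => nth 0 y i.+1 < nth 0 y i
  | Left i =>
      [/\ i < size y,
          forall i', i = i'.+1 -> nth 0 y i < nth 0 y i' &
          odd (size V) -> i.+1 = size y ->
            exists2 i', i = i'.+1 & nth 0 (head [::] (behead V)) i' = nth 0 y i]
  end.

(** Induction on the rows, one case for each rule of the dynamics.  Each
    inequality between the new bottom row [y] and the new row [u2] above it
    follows from the old interlacing and from the monotonicity of [u2], which
    leaves room in the row above for the particle that moves. *)
Lemma rev_ring_valid j X : rev_pattern X -> 0 < j <= size X ->
  let: (m, V) := rev_ring j X in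
  [/\ rev_pattern V, size V = size X,
      head [::] V = apply_move m (head [::] X),
      admissible m V &
      can_move m (head [::] X)].
Proof.
elim: X => [|z U IH]; first by rewrite leqn0; case: j.
move=> pX; have Wz i : nth 0 z i.+1 <= nth 0 z i.
  exact: (@rev_pattern_weyl (z :: U)).
have [sz uz pU] := rev_pattern_consP _ _ pX.
move=> /= /andP[j0 jU]; case: eqVneq => [_|jN].
  split=> //=; last by rewrite !nth_incr_nth /=; have := Wz 0; row_lia.
  apply/rev_pattern_consP; split=> //; first by rewrite size_incr_nth_lt ?sz.
  by move=> i; rewrite !nth_incr_nth; have := uz i; case: i => [|i] /=; row_lia.
have U0 : 0 < size U by row_lia.
have jU' : 0 < j <= size U by row_lia.
have := IH pU jU'; case: (rev_ring j U) => m V [pV sV hV am pos].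
case: U U0 {jU' IH} => [//|u U] _ /= in sz uz pU jU jN pos hV sV pX *.
case: V pV sV hV am => [//|u2 V] pV /= [sV] hV am.
have [su uU pU'] := rev_pattern_consP _ _ pU.
have [su2 uV pV'] := rev_pattern_consP _ _ pV.
rewrite sV in su2.
have Wu i : nth 0 u i.+1 <= nth 0 u i by exact: (@rev_pattern_weyl (u :: U)).
have Wu2 i : nth 0 u2 i.+1 <= nth 0 u2 i by exact: (@rev_pattern_weyl (u2 :: V)).
case: m hV am pos => i /= hV am pos.
- have hu t : nth 0 u2 t = (i == t) + nth 0 u t by rewrite hV nth_incr_nth.
  have iu : i < size u.
    by rewrite ltnNge; apply: contraTN am => ui; rewrite !nth_default ?su2 -?su; row_lia.
  case: eqVneq => [e|ne].
    split=> //; last 2 first.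
    + by rewrite /= sV.
    + by rewrite /= !nth_incr_nth; have := Wz i; row_lia.
    apply/rev_pattern_consP; split=> //; first by rewrite size_incr_nth_lt /= ?sV sz; row_lia.
    move=> t /=; rewrite !nth_incr_nth; have := uz t; have := Wu2 t; rewrite !hu.
    case: (eqVneq i t) => [<-|]; case: (eqVneq i t.+1) => [it|] /=; rewrite -?it; row_lia.
  have {ne} lt : nth 0 u i < nth 0 z i by have := uz i; row_lia.
  case: ifP => [/andP[oddU /eqP il]|nl].
    have iE : i.+1 = size u by row_lia.
    split=> //; last 3 first.
    + by rewrite /= sV.
    + split; first by rewrite /= size_decr_nth; row_lia.
        by move=> i' ii'; rewrite /= !nth_decr_nth; have := Wz i'; rewrite -ii'; row_lia.
      by rewrite /= sV; row_lia.
    + by rewrite /= in pos *; row_lia.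
    apply/rev_pattern_consP; split => /=.
    + by rewrite sV size_decr_nth; row_lia.
    + move=> t; rewrite !nth_decr_nth; have := uz t; have := Wu t.
      case: (eqVneq i t) => [<-|]; case: (eqVneq i t.+1) => [it|] /=; rewrite -?it; row_lia.
    apply/rev_pattern_consP; split=> //; first by rewrite sV.
    move=> t; have := uV t; rewrite !hu; case: (eqVneq i t) => [<-|] /=; last by row_lia.
    have /(nth_default 0) -> : size (head [::] V) <= i.
      case: (V) pV' sV => [|v V'] //= /rev_pattern_consP[-> _ _]; row_lia.
    row_lia.
  have iz : i.+1 < size z by rewrite sz; row_lia.
  split=> //; last 2 first.
  + by rewrite /= sV.
  + by rewrite /= !nth_incr_nth; have := Wz i.+1; row_lia.
  apply/rev_pattern_consP; split=> //; first by rewrite size_incr_nth_lt /= ?sV sz; row_lia.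
  move=> t /=; rewrite !nth_incr_nth; have := uz t; have := Wu2 t; rewrite !hu eqSS.
  case: (eqVneq i t) => [<-|]; case: (eqVneq i.+1 t) => [it|] /=; rewrite -?it; row_lia.
- have hu t : nth 0 u2 t = nth 0 u t - (i == t) by rewrite hV nth_decr_nth.
  have [iu Wi last_i] := am.
  rewrite {}/left_child; case: ifP => [/andP[iz /eqP e]|ne].
    split=> //; last 3 first.
    + by rewrite /= sV.
    + split; first by rewrite /= size_decr_nth.
        by move=> _ [<-]; rewrite /= !nth_decr_nth; have := Wz i; row_lia.
      rewrite /= sV size_decr_nth // => oU iE; exists i => //.
      by rewrite /= nth_decr_nth hu e !eqxx.
    + by rewrite /= in pos *; row_lia.
    apply/rev_pattern_consP; split=> //; first by rewrite /= size_decr_nth ?sV sz; row_lia.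
    move=> t; have := uz t; have := Wu2 i; rewrite !nth_decr_nth /= !hu eqSS.
    case: (eqVneq i t) => [<-|]; case: (eqVneq i.+1 t) => [it|] /=; rewrite -?it; row_lia.
  have zi : nth 0 z i.+1 < nth 0 u i.
    have := uz i; case: (ltnP i.+1 (size z)) ne => [/= _ /eqP|/(nth_default 0) ->]; row_lia.
  have iz : i < size z.
    by rewrite sz -[X in _ < X]/((size U).+1./2.+1); move: iu; rewrite su2; row_lia.
  split=> //; last 3 first.
  + by rewrite /= sV.
  + split; first by rewrite /= size_decr_nth.
      by move=> i1 ii; rewrite /= !nth_decr_nth; have := Wz i1; have := uz i; rewrite -ii; row_lia.
    rewrite /= sV size_decr_nth // => oU iE; move: iu; rewrite su2; row_lia.
  + have := uz i; row_lia.
  apply/rev_pattern_consP; split=> //; first by rewrite /= size_decr_nth ?sV sz; row_lia.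
  move=> t; have := uz t; have := Wu2 t; rewrite !nth_decr_nth /= !hu.
  case: (eqVneq i t) => [<-|]; case: (eqVneq i t.+1) => [it|] /=; rewrite -?it; try row_lia.
Qed.

Arguments decr_nth : simpl never.

(** Reversal of a cascade: from the jump [m] of the bottom row [y] and the new
    rows, recover the clock and the old rows.  After a right jump of particle
    [i], the particles [i] of the two rows coincide exactly when it was pushed
    from directly above; otherwise it was pushed by particle [i.-1], or was
    moved by its own clock if [i = 0].  After a left jump of particle [i], the
    equality of particle [i.-1] of the row above with it tells that it was
    pulled by that particle; otherwise the cause has index [i], and it is a
    suppressed right jump exactly when [i] is last in an odd row and a right
    jump of [u] there would respect the row above. *)
Fixpoint unring (m : move) (y : seq nat) (V : seq (seq nat)) :
    nat * seq (seq nat) :=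
  if V is u :: V' then
    match m with
    | Right i =>
        if nth 0 u i == nth 0 y i then
          let: (j, X) := unring (Right i) u V' in (j, decr_nth y i :: X)
        else if i is i'.+1 then
          let: (j, X) := unring (Right i') u V' in (j, decr_nth y i :: X)
        else ((size V).+1, decr_nth y i :: V)
    | Left i =>
        let: (j, X) :=
          if (0 < i) && (nth 0 u i.-1 == nth 0 y i) then unring (Left i.-1) u V'
          else if [&& odd (size V), i.+1 == size u &
                      ~~ ((0 < i) && (nth 0 (head [::] V') i.-1 == nth 0 u i))]
          then unring (Right i) (incr_nth u i) V'
          else unring (Left i) u V' in
        (j, incr_nth y i :: X)
    end
  else (1, [:: decr_nth y 0]).

(** Injectivity of the cascades: each rule leaves between the two new rows the
    equality or strict inequality that [unring] tests. *)
Lemma rev_ringK j X : rev_pattern X -> 0 < j <= size X ->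
  let: (m, V) := rev_ring j X in unring m (head [::] V) (behead V) = (j, X).
Proof.
elim: X => [|z U IH]; first by rewrite leqn0; case: j.
move=> pX; have Wz i : nth 0 z i.+1 <= nth 0 z i.
  exact: (@rev_pattern_weyl (z :: U)).
have [sz uz pU] := rev_pattern_consP _ _ pX.
move=> /= /andP[j0 jU]; case: eqVneq => [jE|jN].
  rewrite /= jE; case: U sz uz {IH pX pU jU jE} => [|u U] /= sz uz.
    by rewrite incr_nthK ?sz.
  rewrite nth_incr_nth /=; have := uz 0; case: eqP => [|_ _]; first by row_lia.
  by rewrite incr_nthK ?sz.
have U0 : 0 < size U by row_lia.
have jU' : 0 < j <= size U by row_lia.
have := IH pU jU'; have := rev_ring_valid pU jU'.
case: (rev_ring j U) => m V [pV sV hV am pos].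
case: U U0 {jU' IH} => [//|u U] _ /= in sz uz pU jU jN pos hV sV pX *.
case: V pV sV hV am => [//|u2 V] pV /= [sV] hV am.
have [su uU pU'] := rev_pattern_consP _ _ pU.
have [su2 uV pV'] := rev_pattern_consP _ _ pV.
rewrite sV in su2.
have Wu i : nth 0 u i.+1 <= nth 0 u i by exact: (@rev_pattern_weyl (u :: U)).
have Wu2 i : nth 0 u2 i.+1 <= nth 0 u2 i by exact: (@rev_pattern_weyl (u2 :: V)).
case: m hV am pos => i /= hV am pos.
- have hu t : nth 0 u2 t = (i == t) + nth 0 u t by rewrite hV nth_incr_nth.
  have iu : i < size u.
    by rewrite ltnNge; apply: contraTN am => ui; rewrite !nth_default ?su2 -?su; row_lia.
  have iz : i < size z by row_lia.
  case: eqVneq => [e|ne] IH.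
    by rewrite /= nth_incr_nth hu eqxx e eqxx IH incr_nthK.
  have {ne} lt : nth 0 u i < nth 0 z i by have := uz i; row_lia.
  case: ifP => [/andP[oddU /eqP il]|nl].
    have iE : i.+1 = size u by row_lia.
    rewrite /= -sV in oddU; rewrite /= oddU iE eqxx.
    rewrite decr_nthK; last row_lia.
    case: ifP => [|_].
      rewrite nth_decr_nth; have := uz i.-1.
      by case: (i) lt => //= i'; have := Wz i'; row_lia.
    case: ifP => [|/negbT]; first by rewrite -hV IH.
    rewrite negbK => /andP[i0 /eqP e].
    by have := uV i.-1; rewrite e prednK // !hu eqxx; row_lia.
  have iz1 : i.+1 < size z by rewrite sz; row_lia.
  rewrite /= nth_incr_nth eqxx hu.
  case: eqVneq => [|_]; first by have := uz i.+1; row_lia.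
  by rewrite IH incr_nthK.
- have hu t : nth 0 u2 t = nth 0 u t - (i == t) by rewrite hV nth_decr_nth.
  have [iu Wi last_i] := am.
  rewrite /left_child => IH; case ne: (_ && (nth 0 u i == _)).
    have /andP[iz /eqP e] := ne.
    by rewrite /= nth_decr_nth hu e !eqxx /= IH decr_nthK // -e.
  have zi : nth 0 z i.+1 < nth 0 u i.
    have := uz i; case: (ltnP i.+1 (size z)) ne => [/= _ /eqP|/(nth_default 0) ->]; row_lia.
  rewrite /= nth_decr_nth eqxx decr_nthK; last by have := uz i; row_lia.
  case: ifP => [/andP[i0]|_].
    rewrite hu (_ : i == i.-1 = false); last row_lia.
    by have := uz i.-1; have := uz i; have := Wz i.-1; rewrite prednK //; row_lia.
  case: ifP => [/and3P[oV /eqP iE]|_]; last by rewrite IH.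
  have [i' ii e] := last_i oV iE; by rewrite [i.-1](_ : _ = i') ?e ?eqxx ?ii.
Qed.

(** Surjectivity onto the admissible outcomes.  Going up, the jump recovered
    for the row above is admissible again; in the case of a suppressed jump the
    row above has to be replaced by the row [incr_nth u i] that was attempted. *)
Lemma unringK m y V : rev_pattern (y :: V) -> admissible m (y :: V) ->
  let: (j, X) := unring m y V in
  [/\ rev_pattern X, size X = (size V).+1, 0 < j <= size X,
      y = apply_move m (head [::] X) & rev_ring j X = (m, y :: V)].
Proof.
elim: V m y => [|u V IH] m y pY am.
  have [sy _ _] := rev_pattern_consP _ _ pY.
  case: m am => i /= [].
    case: i => [|i]; last by rewrite !nth_default // sy.
    move=> y10; rewrite decr_nthK; last row_lia.
    split=> //; apply/rev_pattern_consP; split=> //; first by rewrite size_decr_nth sy.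
    by move=> i; rewrite nth_nil /= nth_default ?size_decr_nth ?sy.
  by move=> iy _ /(_ isT); case=> [|i' ii _]; move: iy; rewrite sy /=; row_lia.
have [sy uy pU] := rev_pattern_consP _ _ pY.
have [su vu pV] := rev_pattern_consP _ _ pU.
have Wu i : nth 0 u i.+1 <= nth 0 u i by exact: (@rev_pattern_weyl (u :: V)).
rewrite /= in sy uy.
case: m am => i /= am; last first.
  have [iy Wi last_i] := am; rewrite {am}.
  have iz : i < size y by [].
  have hz t : nth 0 (incr_nth y i) t = (i == t) + nth 0 y t by rewrite nth_incr_nth.
  case: ifP => [/andP[i0 /eqP e]|ne].
    (* The particle was pulled by particle [i.-1] of the row above. *)
    have adm : admissible (Left i.-1) (u :: V).
      split=> /=; first by rewrite su; row_lia.
        move=> i' ii; have := Wi i.-1; rewrite prednK // -e => /(_ erefl).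
        by have := uy i'; rewrite -ii; row_lia.
      by move=> oV; rewrite su; row_lia.
    have := IH _ _ pU adm; case: (unring _ _ _) => j X [pX sX jX hu rX].
    have hX t : nth 0 u t = nth 0 (head [::] X) t - (i.-1 == t) by rewrite hu nth_decr_nth.
    have [_ _ _ _ pos] : [/\ True, True, True, True & 0 < nth 0 (head [::] X) i.-1].
      by have := rev_ring_valid pX jX; rewrite rX => -[].
    split=> //.
    + apply/rev_pattern_consP; split=> //; first by rewrite size_incr_nth_lt // sX.
      move=> t; have := uy t; rewrite !hz hX; have := Wi i.-1; rewrite prednK // => /(_ erefl).
      have := hX i.-1; rewrite eqxx e.
      case: (eqVneq i.-1 t) => [<-|]; case: (eqVneq i t.+1) => [it|]; rewrite ?prednK //; row_lia.
    + by rewrite /= sX.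
    + by rewrite /=; row_lia.
    + by rewrite /= incr_nthK.
    rewrite /= sX (_ : j == _ = false); last row_lia.
    rewrite rX /left_child prednK // size_incr_nth_lt // iz hz eqxx.
    have -> : nth 0 (head [::] X) i.-1 == true + nth 0 y i.
      by have := hX i.-1; rewrite eqxx e; row_lia.
    by rewrite /= incr_nthK.
  have ui : forall i', i = i'.+1 -> nth 0 y i < nth 0 u i'.
    by move=> i' ii; have := uy i'; move: ne; rewrite ii /=; case: eqP; row_lia.
  have iu : i < size u.
    rewrite su ltnNge; apply/negP => ui'.
    have [||i' ii e] := last_i; rewrite /= ?sy; try row_lia.
    by have := ui _ ii; rewrite e ltnn.
  case: ifP => [/and3P[oV /eqP iE nv]|nv].
    (* The left jump comes from a suppressed right jump of [u]. *)
    have vi : forall i', i = i'.+1 -> nth 0 u i < nth 0 (head [::] V) i'.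
      by move=> i' ii; have := vu i'; move: nv; rewrite ii /=; case: eqP; row_lia.
    have pU2 : rev_pattern (incr_nth u i :: V).
      apply/rev_pattern_consP; split=> //; first by rewrite size_incr_nth_lt.
      move=> t; have := vu t; rewrite !nth_incr_nth; have := vi t.
      case: (eqVneq i t) => [<-|]; case: (eqVneq i t.+1) => [it|]; rewrite -?it; row_lia.
    have adm : admissible (Right i) (incr_nth u i :: V).
      by rewrite /= !nth_incr_nth eqxx; have := Wu i; row_lia.
    have := IH _ _ pU2 adm; case: (unring _ _ _) => j X [pX sX jX hu rX].
    have {hu} hu : head [::] X = u.
      have sh : size (head [::] X) = size u.
        by case: (X) pX sX => // x X' /rev_pattern_consP[-> _ _] /= [->]; rewrite su.
      have := congr1 (decr_nth^~ i) hu; rewrite /= !incr_nthK // ?sh //.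
    have yi : nth 0 u i < (nth 0 y i).+1 by have := uy i; row_lia.
    split=> //.
    + apply/rev_pattern_consP; split=> //; first by rewrite size_incr_nth_lt // sX.
      move=> t; have := uy t; rewrite !hz hu; have := ui t.
      case: (eqVneq i t) => [<-|]; case: (eqVneq i t.+1) => [it|]; rewrite -?it; row_lia.
    + by rewrite /= sX.
    + by rewrite /=; row_lia.
    + by rewrite /= incr_nthK.
    rewrite /= sX (_ : j == _ = false); last row_lia.
    rewrite rX hu hz eqxx.
    case: eqP => [|_]; first by row_lia.
    rewrite (_ : _ && _ = true); last by rewrite /= oV; row_lia.
    by rewrite incr_nthK.
  have adm : admissible (Left i) (u :: V).
    split=> //=.
      by move=> i' ii; have := ui _ ii; have := uy i; row_lia.
    move=> oV iE; move: nv; rewrite /= oV iE eqxx /= => /negbFE/andP[i0 /eqP e].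
    by exists i.-1; rewrite ?prednK.
  have := IH _ _ pU adm; case: (unring _ _ _) => j X [pX sX jX hu rX].
  have hX t : nth 0 u t = nth 0 (head [::] X) t - (i == t) by rewrite hu nth_decr_nth.
  have [_ _ _ _ pos] : [/\ True, True, True, True & 0 < nth 0 (head [::] X) i].
    by have := rev_ring_valid pX jX; rewrite rX => -[].
  split=> //.
  + apply/rev_pattern_consP; split=> //; first by rewrite size_incr_nth_lt // sX.
    move=> t; have := uy t; rewrite !hz; have := hX t; have := ui t.
    case: (eqVneq i t) => [<-|]; case: (eqVneq i t.+1) => [it|]; rewrite -?it; row_lia.
  + by rewrite /= sX.
  + by rewrite /=; row_lia.
  + by rewrite /= incr_nthK.
  rewrite /= sX (_ : j == _ = false); last row_lia.
  rewrite rX /left_child (_ : _ && _ = false) ?incr_nthK //.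
  by apply/negbTE; rewrite hz; have := hX i; have := uy i; rewrite eqxx; row_lia.
have iy : i < size y.
  by rewrite ltnNge; apply: contraTN am => yi; rewrite !nth_default //; row_lia.
have sz : size (decr_nth y i) = size y by rewrite size_decr_nth.
have hz t : nth 0 (decr_nth y i) t = nth 0 y t - (i == t) by rewrite nth_decr_nth.
have yi0 : 0 < nth 0 y i by row_lia.
case: ifP => [/eqP e|/eqP ne].
  have iu : i < size u.
    by rewrite ltnNge; apply: contraTN yi0 => ui; rewrite -e nth_default.
  have adm : admissible (Right i) (u :: V).
    by rewrite /= e; have := uy i.+1; row_lia.
  have := IH _ _ pU adm; case: (unring _ _ _) => j X [pX sX jX hu rX].
  have hX t : nth 0 u t = (i == t) + nth 0 (head [::] X) t by rewrite hu nth_incr_nth.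
  split=> //.
  + apply/rev_pattern_consP; split=> //; first by rewrite sz sX.
    move=> t; have := uy t; rewrite !hz; have := hX t; have := hX i; rewrite eqxx.
    case: (eqVneq i t) => [<-|]; case: (eqVneq i t.+1) => [it|]; rewrite -?it; row_lia.
  + by rewrite /= sX.
  + by rewrite /=; row_lia.
  + by rewrite /= decr_nthK.
  rewrite /= sX (_ : j == _ = false); last row_lia.
  rewrite rX hz (_ : _ == _); first by rewrite decr_nthK.
  by have := hX i; rewrite e eqxx; row_lia.
case: i => [|i] in am iy sz hz yi0 ne *.
  split=> //.
  + apply/rev_pattern_consP; split=> //; first by rewrite sz.
    by move=> t; have := uy t; rewrite !hz /=; case: t => [|t] /=; row_lia.
  + by rewrite /= leqnn.
  + by rewrite /= decr_nthK.
  by rewrite /= eqxx decr_nthK.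
have lt : nth 0 u i.+1 < nth 0 y i.+1 by have := uy i.+1; row_lia.
have adm : admissible (Right i) (u :: V).
  by rewrite /=; have := uy i; row_lia.
have := IH _ _ pU adm; case: (unring _ _ _) => j X [pX sX jX hu rX].
have hX t : nth 0 u t = (i == t) + nth 0 (head [::] X) t by rewrite hu nth_incr_nth.
split=> //.
+ apply/rev_pattern_consP; split=> //; first by rewrite sz sX.
  move=> t; have := uy t; rewrite !hz; have := hX t; rewrite eqSS.
  case: (eqVneq i t) => [<-|]; case: (eqVneq i.+1 t) => [it|]; rewrite -?it; row_lia.
+ by rewrite /= sX.
+ by rewrite /=; row_lia.
+ by rewrite /= decr_nthK.
rewrite /= sX (_ : j == _ = false); last row_lia.
rewrite rX hz (_ : _ == _ = false); last by have := hX i; have := uy i; rewrite eqxx; row_lia.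
rewrite (_ : _ && _ = false); first by rewrite decr_nthK.
by apply/negbTE; rewrite /=; row_lia.
Qed.

Lemma head_rev (T : Type) (x : T) s : head x (rev s) = last x s.
Proof. by case/lastP: s => [|s y] //; rewrite rev_rcons last_rcons. Qed.

Lemma level_last n z : size z = n -> level z n = head [::] (rev z).
Proof.
by move=> <-; rewrite head_rev /level -[size z]/(size ([::] :: z)).-1 nth_last.
Qed.

Lemma pattern_revE m z :
  (shape z == [seq k.+1./2 | k <- iota 1 m]) && sorted interlaced z =
  (size z == m) && rev_pattern (rev z).
Proof.
elim/last_ind: z m => [|z y IH] [|m] //.
  by rewrite /shape map_rcons /= size_rcons; case: [seq size i | i <- z].
have -> : iota 1 m.+1 = rcons (iota 1 m) m.+1 by rewrite -{1}(addn1 m) iotaD cats1 add1n.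
rewrite /shape !map_rcons eqseq_rcons -/(shape z) size_rcons eqSS rev_rcons.
have -> : sorted interlaced (rcons z y) =
          sorted interlaced z && interlaced (head [::] (rev z)) y.
  by case: z {IH} => [|x s] //=; rewrite rcons_path head_rev.
have {}IH := IH m; rewrite /rev_pattern -/rev_pattern size_rev.
case: (eqVneq (size z) m) IH => [<-|_] /=.
  by move=> <-; case: (shape z == _); case: (size y == _); case: (sorted _ z);
    case: (interlaced _ y).
by case: (shape z == _) => //= ->; rewrite andbF.
Qed.

Lemma is_patternP n z :
  reflect (size z = n.*2 /\ rev_pattern (rev z)) (is_pattern n z).
Proof. by rewrite /is_pattern pattern_revE; apply: (iffP andP) => -[/eqP ? ?]. Qed.

Lemma rev_ring_cons j z U : rev_ring j (z :: U) =
  if j == (size U).+1 then (Right 0, incr_nth z 0 :: U) else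
  let: (m, V) := rev_ring j U in
  let u := head [::] U in
  match m with
  | Right i =>
      if nth 0 u i == nth 0 z i then (Right i, incr_nth z i :: V)
      else if odd (size U) && (i.+1 == (size U).+1./2)
      then (Left i, decr_nth z i :: u :: behead V)
      else (Right i.+1, incr_nth z i.+1 :: V)
  | Left i =>
      let i' := left_child u z i in (Left i', decr_nth z i' :: V)
  end.
Proof. by []. Qed.

Arguments rev_ring : simpl never.

(** [catrev below (cur :: A)] lists, from the bottom, the rows [below] under
    [cur], itself under [A]; the cascade has already transformed [cur :: A], and
    [left_jump] computes what it does to the rest. *)
Lemma left_jump_rev j i cur A below V :
  rev_ring j (cur :: A) = (Left i, decr_nth cur i :: V) -> j <= (size A).+1 ->
  (rev_ring j (catrev below (cur :: A))).2 = catrev (left_jump i cur below) V.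
Proof.
elim: below i cur A V => [|next below IH] i cur A V e jA /=; first by rewrite e.
have jn : j == (size (cur :: A)).+1 = false by rewrite /=; row_lia.
case: ifP => cond; apply: IH => /=; try (by row_lia);
  by rewrite rev_ring_cons jn e /left_child /= cond.
Qed.

Lemma right_attempt_rev j i cur A below V :
  rev_ring j (cur :: A) = (Right i, incr_nth cur i :: V) -> j <= (size A).+1 ->
  (rev_ring j (catrev below (cur :: A))).2 =
  catrev (right_attempt (size A).+1 i cur below) V.
Proof.
elim: below i cur A V => [|next below IH] i cur A V e jA /=; first by rewrite e.
have jn : j == (size (cur :: A)).+1 = false by rewrite /=; row_lia.
have E : rev_ring j (next :: cur :: A) =
  if nth 0 cur i == nth 0 next i then (Right i, incr_nth next i :: incr_nth cur i :: V)
  else if odd (size A).+1 && (i.+1 == (size A).+2./2)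
  then (Left i, decr_nth next i :: cur :: V)
  else (Right i.+1, incr_nth next i.+1 :: incr_nth cur i :: V).
  by rewrite rev_ring_cons jn e.
case: ifP E => _; first by move=> /IH -> //=; row_lia.
by case: ifP => _ E; [apply: left_jump_rev E _|apply: IH E _]; rewrite /=; row_lia.
Qed.

Lemma clock_ring_rev k z : 0 < k <= size z ->
  clock_ring k z = rev (rev_ring k (rev z)).2.
Proof.
case: k => // k /= kz; rewrite /clock_ring /level /=.
have -> : rev z = catrev (drop k.+1 z) (nth [::] z k :: rev (take k z)).
  by rewrite -{1}(cat_take_drop k z) (drop_nth [::]) // rev_cat rev_cons cat_rcons catrevE.
have sA : size (rev (take k z)) = k by rewrite size_rev size_takel //; row_lia.
have := @right_attempt_rev k.+1 0 (nth [::] z k) (rev (take k z))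
  (drop k.+1 z) (rev (take k z)).
rewrite rev_ring_cons sA eqxx => -> //.
by rewrite catrevE rev_cat !revK.
Qed.

(** * Clock rings as a bijection *)
Lemma clock_ring_pattern n k z :
  is_pattern n z -> 0 < k <= n.*2 -> is_pattern n (clock_ring k z).
Proof.
move=> /is_patternP[sz pz] kn; rewrite clock_ring_rev ?sz //.
have := @rev_ring_valid k _ pz; rewrite size_rev sz => /(_ kn).
case: rev_ring => m V [pV sV _ _ _] /=.
by apply/is_patternP; rewrite size_rev revK sV.
Qed.

Lemma apply_move_inj m m' y : can_move m y -> can_move m' y ->
  apply_move m y = apply_move m' y -> m = m'.
Proof.
have D i j : 0 < nth 0 y j -> incr_nth y i = decr_nth y j -> False.
  move=> yj /(congr1 (fun s => nth 0 s j)).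
  by rewrite nth_incr_nth nth_decr_nth eqxx; row_lia.
case: m m' => i [] j //= pi pj.
- move=> /(congr1 (fun s => nth 0 s i)); rewrite !nth_incr_nth eqxx.
  by case: (eqVneq j i) => [->|] // _; row_lia.
- by move=> /(D _ _ pj).
- by move=> /esym/(D _ _ pi).
move=> /(congr1 (fun s => nth 0 s i)); rewrite !nth_decr_nth eqxx.
by case: (eqVneq j i) => [->|] // _; row_lia.
Qed.

(** The old and new bottom rows determine the last jump of the cascade
    ([apply_move_inj]), from which [unring] recovers everything else. *)
Lemma clock_ring_inj n k k' z z' :
  is_pattern n z -> is_pattern n z' -> 0 < k <= n.*2 -> 0 < k' <= n.*2 ->
  level z n.*2 = level z' n.*2 -> clock_ring k z = clock_ring k' z' ->
  k = k' /\ z = z'.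
Proof.
move=> /is_patternP[sz pz] /is_patternP[sz' pz'] kn kn'.
rewrite !level_last // !clock_ring_rev ?sz ?sz' // => eb /(can_inj revK).
have := @rev_ring_valid k _ pz; have := @rev_ring_valid k' _ pz'.
have := @rev_ringK k _ pz; have := @rev_ringK k' _ pz'.
rewrite !size_rev sz sz' => /(_ kn') + /(_ kn) + /(_ kn') + /(_ kn).
case: rev_ring => m' V'; case: rev_ring => m V /= E' E.
move=> [pV' sV' hV' _ pos'] [pV sV hV _ pos] VV'.
have mm : m = m'.
  apply: (@apply_move_inj _ _ (head [::] (rev z))); first exact: pos.
    by rewrite eb; exact: pos'.
  by rewrite -hV VV' hV' eb.
have : (k, rev z) = (k', rev z') by rewrite -E -E' VV' mm.
by move=> [-> /(can_inj revK)].
Qed.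

Definition row_succ n (z y : seq nat) := exists2 i, i < n & y = incr_nth z i.

Lemma clock_ring_bottom n k z : is_pattern n z -> 0 < k <= n.*2 ->
  row_succ n (level z n.*2) (level (clock_ring k z) n.*2) \/
  row_succ n (level (clock_ring k z) n.*2) (level z n.*2).
Proof.
move=> pz kn; have /is_patternP[sc pc] := clock_ring_pattern pz kn.
move: pz => /is_patternP[sz pz]; rewrite !level_last //.
rewrite clock_ring_rev ?sz // revK in pc sc *.
have := @rev_ring_valid k _ pz; rewrite size_rev sz => /(_ kn).
case: rev_ring pc sc => m V /= _ _ [pV sV hV am pos]; rewrite hV.
have sV' : size (head [::] V) = n.
  case: (V) sV kn pV => [<-|v V'] /=; first by row_lia.
  move=> sV kn /rev_pattern_consP[-> _ _]; row_lia.
case: m am hV pos => i /= am hV pos.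
  left; exists i => //; rewrite -sV' ltnNge; apply: contraTN am => ui.
  by rewrite !nth_default //; row_lia.
by right; exists i; [case: am; rewrite sV'|rewrite decr_nthK].
Qed.

(** A left jump of an even row is admissible as soon as the old row is weakly
    decreasing, because the restriction in [admissible] concerns odd rows only;
    the bottom row has the even level [n.*2]. *)
Lemma clock_ring_onto n x z :
  is_pattern n x -> is_weyl n z ->
  row_succ n (level x n.*2) z \/ row_succ n z (level x n.*2) ->
  exists k x', [/\ 0 < k <= n.*2, is_pattern n x', level x' n.*2 = z
    & clock_ring k x' = x].
Proof.
move=> /is_patternP[sx px] /andP[/eqP sz /(sortedP 0) Wz].
have {}Wz i : nth 0 z i.+1 <= nth 0 z i.
  by have [/Wz //|iz] := ltnP i.+1 (size z); rewrite (nth_default _ iz).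
rewrite (level_last sx); case eX : (rev x) px => [|y V] /= px.
  have n0 : n = 0 by have := congr1 size eX; rewrite size_rev sx /=; row_lia.
  by rewrite n0; case=> -[].
have sV : (size V).+1 = n.*2 by rewrite -sx -(size_rev x) eX.
have [sy _ _] := rev_pattern_consP _ _ px.
have {}sy : size y = n by rewrite sy -[_.+2./2]/((size V).+1).+1./2 sV; row_lia.
move=> succ; have [m [am zm]] : exists m, admissible m (y :: V) /\
    forall r, y = apply_move m r -> size r = n ->
      can_move m r -> r = z.
  case: succ => -[i i_n yz].
    exists (Left i); split; last first.
      by move=> r /= e sr r0; rewrite yz e decr_nthK.
    split=> /=; first by rewrite sy.
      by move=> i' ii; have := Wz i'; rewrite yz !nth_incr_nth -ii eqxx; row_lia.
    by move=> oV; row_lia.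
  exists (Right i); split; last first.
    move=> r /= e sr _; rewrite -(@incr_nthK z i) -?yz ?sz // e.
    by rewrite incr_nthK ?sr.
  by rewrite /= yz !nth_incr_nth eqxx; have := Wz i; row_lia.
have := unringK px am; case: unring => j X [pX sX jX hX rX].
have sX' : size X = n.*2 by rewrite sX.
have srX : size (rev X) = n.*2 by rewrite size_rev.
exists j, (rev X); split.
- by rewrite -sX'.
- by apply/is_patternP; rewrite revK.
- rewrite (level_last srX) revK; apply: zm => //.
    case: (X) pX sX => // r X' /rev_pattern_consP[-> _ _] /= [sV'].
    by move: sV; rewrite -sV'; row_lia.
  by have := rev_ring_valid pX jX; rewrite rX => -[].
by rewrite clock_ring_rev ?srX -?sX' // revK rX /= -eX revK.
Qed.

(** * Change of the weight during a cascade *)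
Lemma level_rev_cons y U k :
  level (rev (y :: U)) k = if k == (size U).+1 then y else level (rev U) k.
Proof.
rewrite rev_cons /level -rcons_cons nth_rcons [size _]/= size_rev.
by case: ltngtP => // kU; rewrite nth_default //= size_rev ltnW.
Qed.

Lemma sumn_incr_nth s i : sumn (incr_nth s i) = (sumn s).+1.
Proof.
elim: s i => [|x s IH] [|i] //=; last by rewrite IH addnS.
by elim: i => //= i.
Qed.

Definition is_right (m : move) : bool := if m is Right _ then true else false.

Lemma sumn_apply_move m y : can_move m y ->
  sumn (apply_move m y) + ~~ is_right m = sumn y + is_right m.
Proof.
case: m => i /= h; first by rewrite sumn_incr_nth addn0 addn1.
by rewrite -{2}(decr_nthK h) sumn_incr_nth addn0 addn1.
Qed.

(** Going down, a cascade keeps its direction; it can only turn from right to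
    left, at the passage from an odd row to an even one, and the odd row then
    stays where it was. *)
Lemma rev_ring_direction k y U : k <= size U -> rev_pattern (y :: U) -> 0 < k ->
  let: (m, V) := rev_ring k U in
  let: (m', W) := rev_ring k (y :: U) in
  (is_right m' = is_right m /\ behead W = V) \/
  [/\ odd (size U), is_right m, ~~ is_right m' & behead W = head [::] U :: behead V].
Proof.
move=> kU pY k0; rewrite rev_ring_cons ltn_eqF //.
case: rev_ring => [[i|i] V] /=; last by left.
case: ifP => _; first by left.
by case: ifP => [/andP[oU _]|_]; [right|left].
Qed.

(** The two rows [u], [z] of levels 2l-1 and 2l, with [X] ending in level 2l-2,
    are those in which the exponent of a_l is read.  If a cascade runs through
    all three levels, their sums change by e, e, e with e = 1 or -1, or by
    1, 0, -1 in case of suppression, and twice the middle change equals the sum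
    of the two others in both cases.  If it starts at level 2l-1, the changes
    are 0, 1, 1 or 0, 0, -1 and the exponent grows by one. *)
Lemma rev_ring_pair k z u X : odd (size X) = false ->
  rev_pattern [:: z, u & X] -> 0 < k <= (size X).+1 ->
  exists z' u' V, [/\ (rev_ring k [:: z, u & X]).2 = [:: z', u' & V],
    V = (if k <= size X then (rev_ring k X).2 else X), size V = size X &
    2 * sumn u' + sumn z + sumn (head [::] X) =
    2 * sumn u + sumn z' + sumn (head [::] V) + (k == (size X).+1)].
Proof.
move=> oX pZ /andP[k0 kX].
have /rev_pattern_consP[_ _ pU] := pZ; have /rev_pattern_consP[_ _ pX] := pU.
have kU : 0 < k <= size (u :: X) by rewrite k0.
have kZ : 0 < k <= size [:: z, u & X] by rewrite /=; row_lia.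
have := @rev_ring_direction k z (u :: X) kX pZ k0.
have := rev_ring_valid pU kU; have := rev_ring_valid pZ kZ.
case: (rev_ring k [:: z, u & X]) => m2 [|z' W]; first by case.
move=> [_ /= [sW] hz _ cz].
have sz := sumn_apply_move cz; rewrite -hz in sz.
have {}kX : k < (size X).+1 /\ k <= size X \/ k = (size X).+1 by row_lia.
case: kX => [[_ kX]|kE].
  have kX' : 0 < k <= size X by rewrite k0.
  have := @rev_ring_direction k u X kX pU k0; rewrite oX.
  have := rev_ring_valid pX kX'; rewrite kX (_ : k == _ = false); last row_lia.
  case: (rev_ring k X) => m0 V [_ sV hV _ c0].
  have s0 := sumn_apply_move c0; rewrite -hV in s0.
  case: (rev_ring k (u :: X)) => m1 [|u1 V1] + [//= _ _ hu _ c1] //.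
  have su := sumn_apply_move c1; rewrite -hu in su.
  case=> [[r1 /= E1]|[//]]; subst V1; case=> [[r2 E2]|[_ r1' r2 E2]];
    [exists z', u1, V|exists z', u, V]; split; rewrite ?E2 //.
    by move: r1 r2 su s0 sz; case: (is_right m0) => -> -> /=; row_lia.
  by move: r1 r1' r2 su s0 sz; case: (is_right m0) => -> // _ /negbTE -> /=; row_lia.
rewrite rev_ring_cons kE eqxx ltnn => _ /= dir.
have := sumn_incr_nth u 0.
case: dir => [[r2 E2]|[_ _ r2 E2]];
  [exists z', (incr_nth u 0), X|exists z', u, X]; split; rewrite ?E2 //.
  by move: r2 sz => -> /=; row_lia.
by move: r2 sz => /negbTE -> /=; row_lia.
Qed.

Lemma rev_ring_exponents m k X i : size X = m.*2 -> rev_pattern X ->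
  0 < k <= m.*2 -> i < m ->
  let s l := sumn (level (rev X) l) in
  let s' l := sumn (level (rev (rev_ring k X).2) l) in
  2 * s' i.*2.+1 + s i.*2.+2 + s i.*2 + (k == i.*2.+2) =
  2 * s i.*2.+1 + s' i.*2.+2 + s' i.*2 + (k == i.*2.+1).
Proof.
elim: m X => [|m IH] [|z [|u X]]; rewrite ?doubleS //.
move=> -[sX] pZ km im /=.
have /rev_pattern_consP[_ _ pU] := pZ; have /rev_pattern_consP[_ _ pX] := pU.
have lX (Y : seq (seq nat)) : size Y = m.*2 -> level (rev Y) m.*2 = head [::] Y.
  by move=> sY; rewrite level_last ?revK ?size_rev.
have := rev_ring_pair _ pZ; rewrite sX odd_double => /(_ k erefl) top.
have N1 : (m.*2.+1 == m.*2.+2) = false by row_lia.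
have N2 : (m.*2 == m.*2.+2) = false by row_lia.
have N3 : (m.*2 == m.*2.+1) = false by row_lia.
have N4 : (m.*2.+2 == m.*2.+1) = false by row_lia.
have low : i < m -> [/\ (i.*2.+2 == m.*2.+2) = false, (i.*2.+2 == m.*2.+1) = false,
    (i.*2.+1 == m.*2.+2) = false, (i.*2.+1 == m.*2.+1) = false &
    (i.*2 == m.*2.+2) = false /\ (i.*2 == m.*2.+1) = false].
  by move=> i1; do !split; row_lia.
have [km2|kle] := eqVneq k m.*2.+2.
  rewrite rev_ring_cons /= sX km2 eqxx !level_rev_cons /= sX.
  have [->|iN] := eqVneq i m.
    by rewrite !eqxx N1 N2 N3 N4 sumn_incr_nth; row_lia.
  have i1 : i < m by row_lia.
  have [a2 a1 b2 b1 [c2 c1]] := low i1.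
  by rewrite a1 a2 b1 b2 c1 c2 ![m.*2.+2 == _]eq_sym a2 b2; row_lia.
have /top [z' [u' [V [-> EV sV eq]]]] : 0 < k <= m.*2.+1 by row_lia.
rewrite !level_rev_cons /= sV sX.
have [->|iN] := eqVneq i m.
  by rewrite !eqxx N1 N2 N3 !lX // (negbTE kle); row_lia.
have i1 : i < m by row_lia.
have [a2 a1 b2 b1 [c2 c1]] := low i1; rewrite a1 a2 b1 b2 c1 c2.
rewrite EV; case: ifP => kX; last row_lia.
by apply: IH => //; row_lia.
Qed.

Lemma clock_ring_exponents n k z i : is_pattern n z -> 0 < k <= n.*2 -> i < n ->
  let s l := sumn (level z l) in
  let s' l := sumn (level (clock_ring k z) l) in
  2 * s' i.*2.+1 + s i.*2.+2 + s i.*2 + (k == i.*2.+2) =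
  2 * s i.*2.+1 + s' i.*2.+2 + s' i.*2 + (k == i.*2.+1).
Proof.
move=> /is_patternP[sz pz] kn lin /=; rewrite clock_ring_rev ?sz //.
have := @rev_ring_exponents n k (rev z) i; rewrite size_rev revK; exact.
Qed.

End Combinatorics.

(** * Sums over a discrete set *)
Lemma sum_pick (R : pzSemiRingType) (S : eqType) (s : seq S) x (g : S -> R) :
  uniq s -> x \in s -> \sum_(u <- s) (u == x)%:R * g u = g x.
Proof.
move=> us xs; rewrite (bigD1_seq x) //= eqxx mul1r big1 ?addr0 // => u /negbTE->.
by rewrite mul0r.
Qed.

Lemma esum_ge_seq (R : realType) (S : choiceType) (s : seq S) (f : S -> R) :
  uniq s -> (\sum_(u <- s) (f u)%:E <= \esum_(u in [set: S]) (f u)%:E)%E.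
Proof.
move=> us; apply: esum_ge; exists [set` s]; first by split=> //; exact: finite_seq.
by rewrite -fsbig_seq.
Qed.

Lemma esum_delta (R : realType) (S : choiceType) (x : S) :
  (\esum_(y in [set: S]) ((x == y)%:R : R)%:E = 1)%E.
Proof.
rewrite -(@esum_set1 R _ x (fun=> 1%E)) ?lee01 // [RHS]esum_mkcond.
apply: eq_esum => y _; have [->|ne] := eqVneq x y; first by rewrite mem_set.
by rewrite memNset // => /= e; rewrite e eqxx in ne.
Qed.

(** One inequality is the definition of a supremum of finite sums; the other one
    is the same inequality for the factor [k^-1]. *)
Lemma esumZl (R : realType) (S : choiceType) (D : set S) (k : R)
    (f : S -> \bar R) : 0 <= k -> (forall x, D x -> (0 <= f x)%E) ->
  (\esum_(x in D) (k%:E * f x) = k%:E * \esum_(x in D) f x)%E.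
Proof.
have half (k' : R) (g : S -> \bar R) : 0 <= k' -> (forall x, D x -> (0 <= g x)%E) ->
    (\esum_(x in D) (k'%:E * g x) <= k'%:E * \esum_(x in D) g x)%E.
  move=> k0 g0; apply: ge_ereal_sup => _ [F [finF FD] <-].
  rewrite fsbig_finite //= big_seq -ge0_sume_distrr; last first.
    by move=> x; rewrite in_fset_set // inE => /FD/g0.
  rewrite lee_wpmul2l ?lee_fin // -big_seq -fsbig_finite //.
  by apply: ereal_sup_ubound; exists F.
move=> k0 f0; apply/eqP; rewrite eq_le half //=.
have [<-|kN] := eqVneq 0 k.
  by rewrite mul0e esum_ge0 // => x _; rewrite mul0e.
have {}k0 : 0 < k by rewrite lt_neqAle kN.
have ki : 0 <= k^-1 by rewrite invr_ge0 ltW.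
have := half k^-1 (fun x => k%:E * f x)%E ki.
under eq_esum do rewrite muleA -EFinM mulVf ?gt_eqF // mul1e.
have kf0 x : D x -> (0 <= k%:E * f x)%E.
  by move=> Dx; rewrite mule_ge0 ?f0 // lee_fin ltW.
move=> /(_ kf0) H.
rewrite -[leRHS]mul1e -[1%E]/(1%:E) -(mulfV (lt0r_neq0 k0)) EFinM -muleA.
apply: lee_wpmul2l; first by rewrite lee_fin ltW.
exact: H.
Qed.

(** * Uniformization of a semigroup with bounded rates *)
Lemma bernoulli_ineq (R : realDomainType) (u : R) N :
  -1 <= u -> 1 + N%:R * u <= (1 + u) ^+ N.
Proof.
move=> u1; elim: N => [|N IH]; first by rewrite mul0r addr0.
have u0 : 0 <= 1 + u by lra.
apply: le_trans (_ : (1 + u) * (1 + N%:R * u) <= _); last by rewrite exprS ler_wpM2l.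
have : 0 <= N%:R * u ^+ 2 by rewrite mulr_ge0 ?sqr_ge0.
by rewrite -natr1; nra.
Qed.

(** Each [i] is a clock of rate [r i] whose ring sends [x] to [phi i x]. *)
Section Uniformization.
Variables (R : realType) (S : countType) (I : finType).
Variables (r : I -> R) (phi : I -> S -> S) (p : R -> S -> S -> R).
Let c := \sum_i r i.
Hypothesis r_ge0 : forall i, 0 <= r i.
Hypothesis tp : transition_function p.
Hypothesis rate_p : has_rate_matrix p
  (fun x y => \sum_i r i * ((y == phi i x)%:R - (y == x)%:R)).

Let c_ge0 : 0 <= c. Proof. exact: sumr_ge0. Qed.

Definition euler_step (h : R) (f : S -> R) (x : S) : R :=
  f x + h * \sum_i r i * f (phi i x).

(** With [L f x = \sum_i r i * f (phi i x)], this is [(I + h L)^N f], the Euler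
    approximation of [exp(N h L) f]. *)
Definition euler (N : nat) (h : R) (f : S -> R) : S -> R :=
  iter N (euler_step h) f.

(** The exponential factor compensates the diagonal of the rate matrix: the
    derivative of [G] at 0 is [L], whose entries are nonnegative. *)
Let G (t : R) x y := expR (c * t) * p t x y.

Let G_ge0 t x y : 0 <= t -> 0 <= G t x y.
Proof. by move=> t0; rewrite mulr_ge0 ?expR_ge0 // (transition_ge0 tp). Qed.

(** Chapman-Kolmogorov restricted to finitely many intermediate states. *)
Lemma semigroup_ge (s : seq S) a b x y : uniq s -> 0 <= a -> 0 <= b ->
  \sum_(u <- s) G a x u * G b u y <= G (a + b) x y.
Proof.
move=> us a0 b0; rewrite /G mulrDr expRD -mulrA.
under eq_bigr do rewrite mulrACA.
rewrite -big_distrr /= -mulrA ler_wpM2l ?expR_ge0 //.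
rewrite ler_wpM2l ?expR_ge0 //.
rewrite -lee_fin (transition_semigroup tp) // -sumEFin.
exact: esum_ge_seq.
Qed.

Lemma semigroup_ge1 u a b x y : 0 <= a -> 0 <= b ->
  G a x u * G b u y <= G (a + b) x y.
Proof.
by move=> a0 b0; have := @semigroup_ge [:: u] a b x y isT a0 b0; rewrite big_seq1.
Qed.

(** A lower bound for the difference quotient of [G] at 0, obtained from
    [1 + c h <= exp(c h)], which still converges to the entries of [L]. *)
Definition rate_quotient (h : R) x y :=
  (p h x y - (x == y)%:R) / h + c * p h x y.

Lemma small_step (h : R) x y : 0 < h ->
  (x == y)%:R + h * rate_quotient h x y <= G h x y.
Proof.
move=> h0; rewrite mulrDr mulrC divfK ?gt_eqF // addrCA addrA subrK /G.
have := expR_ge1Dx (c * h); have := transition_ge0 tp x y (ltW h0); nra.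
Qed.

Lemma cvg_rate_quotient x y :
  rate_quotient h x y @[h --> 0^'+] --> \sum_i r i * (y == phi i x)%:R.
Proof.
have -> : \sum_i r i * (y == phi i x)%:R =
  (\sum_i r i * ((y == phi i x)%:R - (y == x)%:R)) +
  c * ((x == y)%:R + 0 * (\sum_i r i * ((y == phi i x)%:R - (y == x)%:R))) :> R.
  rewrite mul0r addr0 mulr_suml -big_split /=; apply: eq_bigr => i _.
  by rewrite [x == y]eq_sym mulrBr subrK.
apply: (@cvg_trans _ ((p h x y - (x == y)%:R) / h +
  c * ((x == y)%:R + h * ((p h x y - (x == y)%:R) / h)) @[h --> 0^'+])).
  apply: near_eq_cvg; near=> h.
  have h0 : h != 0 by rewrite gt_eqF.
  by rewrite /rate_quotient [h * _]mulrC divfK // subrKC.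
have h0 : h @[h --> (0:R)^'+] --> (0:R) by apply: cvg_at_right_filter; exact: cvg_id.
apply: cvgD; first exact: rate_p.
apply: cvgM; first exact: cvg_cst.
apply: cvgD; first exact: cvg_cst.
by apply: cvgM => //; exact: rate_p.
Unshelve. all: by end_near. Qed.

(** Estimates proved for the step [t / N.+1], for every [N], hold in the limit
    with the rates in place of the difference quotients. *)
Lemma le_of_rate_quotient (t b b' : R) x y : 0 < t ->
  (forall N, b + t * rate_quotient (t / N.+1%:R) x y <= b') ->
  b + t * \sum_i r i * (y == phi i x)%:R <= b'.
Proof.
move=> t0 H.
have cv : t / N.+1%:R @[N --> \oo] --> (0 : R).
  rewrite -[X in _ --> X](mulr0 t); apply: cvgM; first exact: cvg_cst.
  exact: cvg_harmonic.
have /cvg_at_rightP/(_ (fun N => t / N.+1%:R)) := @cvg_rate_quotient x y.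
move=> /(_ (conj (fun N => divr_gt0 t0 (ltr0Sn _ _)) cv)) {}cv.
have : b + t * rate_quotient (t / N.+1%:R) x y @[N --> \oo] -->
       b + t * \sum_i r i * (y == phi i x)%:R.
  by apply: cvgD; [exact: cvg_cst|apply: cvgM => //; exact: cvg_cst].
move/cvgr_to_le; apply; exact: nearW.
Qed.

(** Staying at [x] during [N.+1] successive steps gives
    [G h x x ^+ N.+1 <= G t x x], and Bernoulli's inequality makes the power
    linear in the difference quotient. *)
Lemma transition_lower_diag (t : R) x : 0 < t ->
  1 + t * \sum_i r i * (x == phi i x)%:R <= G t x x.
Proof.
move=> t0; apply: le_of_rate_quotient => // N; set h := t / _.
have h0 : 0 < h by rewrite divr_gt0.
have tE : t = N.+1%:R * h by rewrite mulrC divfK // pnatr_eq0.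
have powG M : G h x x ^+ M <= G (M%:R * h) x x.
  elim: M => [|M IH]; first by rewrite mul0r /G mulr0 expR0 mul1r (transition_0 tp) eqxx.
  have Mh : 0 <= M%:R * h by rewrite mulr_ge0 // ltW.
  rewrite -nat1r mulrDl mul1r; apply: le_trans (semigroup_ge1 x x x (ltW h0) Mh).
  by rewrite exprS ler_wpM2l // G_ge0 // ltW.
have small := small_step x x h0; rewrite eqxx in small.
rewrite [X in G X]tE; apply: le_trans (powG _).
have ge0 : 0 <= 1 + h * rate_quotient h x x.
  rewrite mulrDr [h * (_ / h)]mulrC divfK ?gt_eqF // eqxx addrA addrCA subrr addr0.
  by rewrite !(addr_ge0, mulr_ge0) ?(transition_ge0 tp) // ltW.
apply: le_trans (_ : (1 + h * rate_quotient h x x) ^+ N.+1 <= _); last first.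
  by apply: lerXn2r => //; rewrite nnegrE // G_ge0 // ltW.
by apply: le_trans (bernoulli_ineq _ _); [rewrite mulrA -tE|lra].
Qed.

(** Off the diagonal, the path may leave [x] for [y] during any one of the
    [N.+1] steps and stay put during the others, which costs nothing since
    diagonal entries of [G] are at least 1. *)
Lemma transition_lower (t : R) x y : 0 <= t ->
  (x == y)%:R + t * \sum_i r i * (y == phi i x)%:R <= G t x y.
Proof.
rewrite le_eqVlt => /predU1P[<-|t0].
  by rewrite mul0r addr0 /G mulr0 expR0 mul1r (transition_0 tp).
have [->|xy] := eqVneq x y; first exact: transition_lower_diag.
apply: le_of_rate_quotient => // N; set h := t / _.
have h0 : 0 < h by rewrite divr_gt0.
have tE : t = N.+1%:R * h by rewrite mulrC divfK // pnatr_eq0.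
have diag u a : 0 <= u -> 1 <= G u a a.
  rewrite le_eqVlt => /predU1P[<-|u0].
    by rewrite /G mulr0 expR0 mul1r (transition_0 tp) eqxx.
  apply: le_trans (transition_lower_diag a u0).
  rewrite lerDl mulr_ge0 ?(ltW u0) //; by apply: sumr_ge0 => i _; rewrite mulr_ge0.
have addG M : M%:R * G h x y <= G (M%:R * h) x y.
  elim: M => [|M IH]; first by rewrite mul0r G_ge0 // mul0r.
  have Mh : 0 <= M%:R * h by rewrite mulr_ge0 // ltW.
  have := @semigroup_ge [:: x; y] h (M%:R * h) x y.
  rewrite /= inE xy => /(_ isT (ltW h0) Mh).
  rewrite big_cons big_seq1 -nat1r !mulrDl !mul1r; apply: le_trans.
  have := diag h x (ltW h0); have := diag _ y Mh.
  have := G_ge0 x y (ltW h0); have := G_ge0 x y Mh.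
  nra.
rewrite add0r [X in G X]tE; apply: le_trans (addG _).
rewrite [t in X in X <= _]tE -mulrA ler_wpM2l //.
by apply: le_trans (small_step _ _ h0); rewrite (negbTE xy) add0r.
Qed.

Lemma euler_ge0 N h f x : 0 <= h -> (forall u, 0 <= f u) -> 0 <= euler N h f x.
Proof.
move=> h0 f0; elim: N x => [|N IH] x //=; rewrite /euler_step addr_ge0 ?IH //.
by rewrite mulr_ge0 // sumr_ge0 // => i _; rewrite mulr_ge0.
Qed.

(** Iteration of [transition_lower], keeping only the intermediate states [x]
    and [phi i x] in each step. *)
Lemma euler_le_transition N h x y : 0 <= h ->
  euler N h (fun u => (u == y)%:R) x <= G (N%:R * h) x y.
Proof.
move=> h0; elim: N x => [|N IH] x.
  by rewrite mul0r /G mulr0 expR0 mul1r (transition_0 tp).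
have Nh : 0 <= N%:R * h by rewrite mulr_ge0.
rewrite -nat1r mulrDl mul1r.
pose s := undup (x :: [seq phi i x | i : I]).
apply: le_trans (semigroup_ge x y (undup_uniq (x :: [seq phi i x | i : I])) h0 Nh).
rewrite -/s.
have xs : x \in s by rewrite mem_undup mem_head.
have ps i : phi i x \in s by rewrite mem_undup inE map_f ?orbT ?mem_enum.
apply: le_trans (_ : \sum_(u <- s) ((u == x)%:R +
   h * \sum_i r i * (u == phi i x)%:R) * G (N%:R * h) u y <= _); last first.
  apply: ler_sum => u _; apply: ler_wpM2r; first exact: G_ge0.
  by have := transition_lower x u h0; rewrite [x == u]eq_sym.
under eq_bigr do rewrite mulrDl -mulrA mulr_suml.
rewrite big_split /= sum_pick ?undup_uniq // -big_distrr /= exchange_big /=.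
rewrite /euler_step; apply: lerD; first exact: IH.
apply: ler_wpM2l => //; apply: ler_sum => i _.
under eq_bigr do rewrite -mulrA.
by rewrite -big_distrr /= sum_pick ?undup_uniq // ler_wpM2l.
Qed.

Lemma esum_euler N h x : 0 <= h ->
  (\esum_(y in [set: S]) (euler N h (fun u => (u == y)%:R) x)%:E =
   ((1 + c * h) ^+ N)%:E)%E.
Proof.
move=> h0; elim: N x => [|N IH] x /=.
  by rewrite expr0 esum_delta.
have e0 y u : (0 <= (euler N h (fun u => (u == y)%:R) u)%:E)%E.
  by rewrite lee_fin euler_ge0.
rewrite /euler_step; under eq_esum do rewrite EFinD EFinM -sumEFin.
have t0 y i : (0 <= (r i * euler N h (fun u => (u == y)%:R) (phi i x))%:E)%E.
  by rewrite lee_fin mulr_ge0 // euler_ge0.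
rewrite esumD //; last by move=> y _; rewrite mule_ge0 ?lee_fin // sume_ge0.
rewrite IH esumZl //; last by move=> y _; rewrite sume_ge0.
rewrite esum_sum //.
under eq_bigr do [under eq_esum do rewrite EFinM; rewrite esumZl // IH -EFinM].
rewrite sumEFin -mulr_suml -EFinM -EFinD exprS; congr EFin; rewrite /c; ring.
Qed.

(** [G t x] dominates the Euler product termwise, so no single term can exceed
    it by more than the difference of the total masses. *)
Lemma transition_le_euler N h x y : 0 <= h ->
  G (N%:R * h) x y <= euler N h (fun u => (u == y)%:R) x +
                      (expR (c * (N%:R * h)) - (1 + c * h) ^+ N).
Proof.
move=> h0; set t := N%:R * h; set e := fun y => euler N h (fun u => (u == y)%:R) x.
have t0 : 0 <= t by rewrite mulr_ge0.
have eG v : e v <= G t x v by exact: euler_le_transition.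
have sumG : (\esum_(v in [set: S]) (G t x v)%:E = (expR (c * t))%:E)%E.
  under eq_esum do rewrite EFinM.
  rewrite esumZl ?expR_ge0 ?(transition_sum1 tp) ?mule1 // => v _.
  by rewrite lee_fin (transition_ge0 tp).
have : (\esum_(v in [set: S]) (e v)%:E + \esum_(v in [set: S]) (G t x v - e v)%:E
        = (expR (c * t))%:E)%E.
  rewrite -esumD; first last.
  + by move=> v _; rewrite lee_fin subr_ge0.
  + by move=> v _; rewrite lee_fin euler_ge0.
  by rewrite -sumG; apply: eq_esum => v _; rewrite -EFinD addrC subrK.
rewrite esum_euler // => sumE.
have : ((G t x y - e y)%:E <= \esum_(v in [set: S]) (G t x v - e v)%:E)%E.
  by have := @esum_ge_seq R S [:: y] (fun v => G t x v - e v) isT; rewrite big_seq1.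
move=> /(leeD2l ((1 + c * h) ^+ N)%:E); rewrite sumE -EFinD lee_fin -/(e y); lra.
Qed.

(** [(1 + v) exp(-v) >= (1 + v) (1 - v) = 1 - v^2], and Bernoulli's inequality
    for the power [N]. *)
Lemma expR_sub_pow (v : R) N : 0 <= v <= 1 ->
  expR (N%:R * v) - (1 + v) ^+ N <= expR (N%:R * v) * (N%:R * v ^+ 2).
Proof.
move=> /andP[v0 v1].
have le1 : expR v * (1 - v ^+ 2) <= 1 + v.
  have := expR_ge1Dx (- v); rewrite expRN => h.
  have e0 := expR_gt0 v.
  have : expR v * (1 - v) <= 1 by rewrite -ler_pdivlMl // mulr1.
  nra.
have : (expR v * (1 - v ^+ 2)) ^+ N <= (1 + v) ^+ N.
  apply: lerXn2r => //; rewrite nnegrE; last lra.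
  by rewrite mulr_ge0 ?expR_ge0 // subr_ge0 expr_le1.
rewrite exprMn -expRM_natl.
have := @bernoulli_ineq R (- v ^+ 2) N; rewrite lerN2 expr_le1 // => /(_ v1).
have := expR_gt0 (N%:R * v); nra.
Qed.

Lemma euler_cvg_transition (t : R) x y : 0 <= t ->
  euler N.+1 (t / N.+1%:R) (fun u => (u == y)%:R) x @[N --> \oo] -->
  expR (c * t) * p t x y.
Proof.
move=> t0; pose b N := expR (c * t) * ((c * t) ^+ 2 * N.+1%:R^-1).
apply: (@squeeze_cvgr _ _ _ R (fun N => G t x y - b N) (fun=> G t x y)).
- have : \forall N \near \oo, c * t <= (N : nat)%:R by exact: nbhs_infty_ger.
  apply: filterS => N ctN.
  have h0 : 0 <= t / N.+1%:R by rewrite divr_ge0.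
  have tE : N.+1%:R * (t / N.+1%:R) = t by rewrite mulrC divfK // pnatr_eq0.
  have := @euler_le_transition N.+1 _ x y h0; rewrite tE => -> ; rewrite andbT.
  have := @transition_le_euler N.+1 _ x y h0; rewrite tE.
  have v01 : 0 <= c * (t / N.+1%:R) <= 1.
    rewrite mulr_ge0 //= mulrA ler_pdivrMr // mul1r; apply: le_trans ctN _.
    by rewrite ler_nat.
  have := @expR_sub_pow _ N.+1 v01.
  rewrite mulrCA tE (_ : N.+1%:R * _ = (c * t) ^+ 2 * N.+1%:R^-1).
    by rewrite -/(b N); lra.
  by field; rewrite ?natr1 ?nat1r pnatr_eq0.
- rewrite -[X in _ --> X]subr0; apply: cvgB; first exact: cvg_cst.
  rewrite -(mulr0 (expR (c * t))); apply: cvgM; first exact: cvg_cst.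
  rewrite -(mulr0 ((c * t) ^+ 2)); apply: cvgM; first exact: cvg_cst.
  exact: cvg_harmonic.
- exact: cvg_cst.
Qed.
End Uniformization.

(** * Fibres of the bottom row map *)
Lemma finite_seqs (T : choiceType) (A : set T) m : finite_set A ->
  finite_set [set s : seq T | (size s <= m)%N /\ {in s, forall x, A x}].
Proof.
move=> fA; elim: m => [|m IH].
  apply: (@sub_finite_set _ _ [set [::]]); last exact: finite_set1.
  by move=> s /= [/[!leqn0]/nilP].
apply: (@sub_finite_set _ _ ([set [::]] `|`
  (fun xs => xs.1 :: xs.2) @` (A `*` [set s : seq T | (size s <= m)%N /\ {in s, forall x, A x}]))).
  move=> [|x s] /= [sm sA]; [by left|right; exists (x, s) => //=; split].
    by apply: sA; rewrite mem_head.
  by split=> // y ys; apply: sA; rewrite inE ys orbT.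
rewrite finite_setU; split; first exact: finite_set1.
by apply: finite_image; apply: finite_setX.
Qed.

Lemma rev_pattern_bound X row :
  rev_pattern X -> row \in X ->
  (size row <= size (head [::] X))%N /\
  {in row, forall v, (v <= nth 0%N (head [::] X) 0)%N}.
Proof.
elim: X => // y U IH pX; rewrite inE => /predU1P[->|rU].
  split=> // v /(nthP 0%N)[i _ <-] /=; elim: i => // i; apply: leq_trans.
  exact: (@rev_pattern_weyl (y :: U)).
have [sy uy pU] := rev_pattern_consP _ _ pX; have [sr rb] := IH pU rU.
split.
  apply: leq_trans sr _; rewrite /= sy; case: (U) pU => // u U' /rev_pattern_consP[-> _ _].
  by rewrite half_leq.
by move=> v /rb; move/leq_trans; apply; have /andP[] := uy 0%N.
Qed.

Section Patterns.
Variable n : nat.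

(** The clock [(l, b)] is the one of level 2l+1 when [b] is false and 2l+2 when
    [b] is true, [l] being counted from 0. *)
Definition clock_index (i : 'I_n * bool) : nat := (i.1.*2.+1 + i.2)%N.

Lemma clock_index_bound i : (0 < clock_index i <= n.*2)%N.
Proof. by case: i => [[l ln] b]; rewrite /clock_index /=; case: b; lia. Qed.

Lemma clock_index_inj : injective clock_index.
Proof.
move=> [i b] [j b']; rewrite /clock_index /= => e.
have eb : b = b' by case: b b' e => -[] //; lia.
by congr (_, _) => //; apply: val_inj => /=; move: e; rewrite eb; lia.
Qed.

Lemma clock_index_surj k : (0 < k <= n.*2)%N -> exists i, clock_index i = k.
Proof.
move=> kn; have kl : (k.-1./2 < n)%N by lia.
exists (Ordinal kl, ~~ odd k); rewrite /clock_index /=.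
by case: (odd k) (odd_double_half k) => /=; lia.
Qed.

Definition clock_step (i : 'I_n * bool) (x : pattern n) : pattern n :=
  exist _ (clock_ring (clock_index i) (val x))
    (clock_ring_pattern (valP x) (clock_index_bound i)).

Definition neighbour (z y : weyl n) : bool := weyl_succ z y || weyl_succ y z.

Lemma weyl_succP (z y : weyl n) : reflect (row_succ n (val z) (val y)) (weyl_succ z y).
Proof.
apply: (iffP existsP) => [[i /eqP e]|[i ni e]]; first by exists i.
by exists (Ordinal ni); apply/eqP.
Qed.

Lemma clock_step_inj i j x y : bottom_row x = bottom_row y ->
  clock_step i x = clock_step j y -> i = j /\ x = y.
Proof.
move=> /(congr1 val) /= b /(congr1 val) /= e.
have [] := clock_ring_inj (valP x) (valP y) (clock_index_bound i)
  (clock_index_bound j) b e.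
by move=> /clock_index_inj -> /val_inj.
Qed.

Lemma clock_step_bottom i x : neighbour (bottom_row x) (bottom_row (clock_step i x)).
Proof.
have [h|h] := clock_ring_bottom (valP x) (clock_index_bound i); apply/orP.
  by left; apply/weyl_succP.
by right; apply/weyl_succP.
Qed.

Lemma clock_step_onto x z : neighbour z (bottom_row x) ->
  exists i x', bottom_row x' = z /\ clock_step i x' = x.
Proof.
move=> zx.
have succ : row_succ n (level (val x) n.*2) (val z) \/
            row_succ n (val z) (level (val x) n.*2).
  by case/orP: zx => /weyl_succP; [right|left].
have [k [x' [kn px' bx' cx']]] := clock_ring_onto (valP x) (valP z) succ.
have [i ik] := clock_index_surj kn.
exists i, (exist _ x' px'); split; apply: val_inj => //=.
by rewrite ik.
Qed.

Lemma neighbour_irrefl z : neighbour z z = false.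
Proof.
have h (s : seq nat) i : s = incr_nth s i -> False.
  by move/(congr1 (fun s => nth 0%N s i)); rewrite nth_incr_nth eqxx; lia.
by apply/negbTE/norP; split; apply/weyl_succP => -[i _ /h].
Qed.

(** All entries of a pattern are bounded by the first entry of its bottom row. *)
Lemma finite_fibre (z : weyl n) : finite_set [set x : pattern n | bottom_row x = z].
Proof.
pose N := nth 0%N (val z) 0.
have fA : finite_set [set v | (v <= N)%N].
  apply: (@sub_finite_set _ _ `I_N.+1); last exact: finite_II.
  by move=> v /=; rewrite ltnS.
have := finite_seqs n.*2 (finite_seqs n fA).
set F := [set s | _] => fF.
apply: (@sub_finite_set _ _ ((@proj1_sig _ _) @^-1` F)); last first.
  by apply: finite_preimage => // x y _ _; exact: val_inj.
move=> x /= /(congr1 val) /=; have /is_patternP[sx px] := valP x.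
rewrite (level_last sx) /F /= => e; split; first by rewrite -sx.
move=> row; rewrite -mem_rev => /(rev_pattern_bound px) /=; rewrite e.
move=> [sr rb]; split=> //.
by have /andP[/eqP sz _] := valP z; rewrite sz in sr.
Qed.

Definition fibre (z : weyl n) : seq (pattern n) :=
  finmap.enum_fset (fset_set [set x : pattern n | bottom_row x = z]).

Lemma fibre_uniq z : uniq (fibre z).
Proof. exact: finmap.fset_uniq. Qed.

Lemma mem_fibre z x : (x \in fibre z) = (bottom_row x == z).
Proof.
rewrite /fibre (in_fset_set (finite_fibre z)).
by apply/idP/eqP; rewrite inE.
Qed.

(** Truncating [z] to the length required by each level gives a pattern. *)
Lemma fibre_nonempty (z : weyl n) : exists x, bottom_row x = z.
Proof.
case: z => z wz; have /andP[/eqP sz /(sortedP 0%N) Wz] := wz.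
have {}Wz i : (nth 0%N z i.+1 <= nth 0%N z i)%N.
  by have [/Wz //|iz] := ltnP i.+1 (size z); rewrite (nth_default _ iz).
pose X := [seq take k.+1./2 z | k <- iota 1 n.*2].
have nX k : (k < n.*2)%N -> nth [::] X k = take k.+2./2 z.
  by move=> kn; rewrite (nth_map 0%N) ?size_iota // nth_iota.
have pX : is_pattern n X.
  apply/andP; split.
    rewrite /shape -map_comp; apply/eqP/eq_in_map => k /=; rewrite mem_iota => kn.
    by rewrite size_takel //; lia.
  apply/(sortedP [::]) => i; rewrite size_map size_iota => ix.
  rewrite !nX //; last lia.
  apply/allP => j; rewrite mem_iota /= size_take_min => jl.
  rewrite [X in (_ <= X <= _)%N]nth_take; last lia.
  rewrite [X in (_ <= _ <= X)%N]nth_take ?leqnn ?andbT; last lia.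
  have [h|h] := ltnP j.+1 i.+3./2; first by rewrite nth_take.
  by rewrite nth_default // size_take_min; lia.
exists (exist _ X pX); apply: val_inj => /=.
have [n0|n0] := posnP n.
  by rewrite n0 /level /=; apply/esym/size0nil; rewrite sz.
rewrite /level -(prednK (_ : 0 < n.*2)%N) /=; last by lia.
by rewrite nX ?take_oversize // ?sz ?prednK //; lia.
Qed.
End Patterns.

(** * Intertwining of the dynamics with the Gibbs laws *)
Lemma cvg_sum_seq (R : realFieldType) (T : Type) (F : set_system T) (J : eqType)
    (s : seq J) (f : J -> T -> R) (l : J -> R) : ProperFilter F ->
  (forall j, j \in s -> f j x @[x --> F] --> l j) ->
  \sum_(j <- s) f j x @[x --> F] --> \sum_(j <- s) l j.
Proof.
move=> FF; elim: s => [|j s IH] fl.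
  by under eq_cvg do rewrite big_nil; rewrite big_nil; exact: cvg_cst.
under eq_cvg do rewrite big_cons; rewrite big_cons.
apply: cvgD; first by apply: fl; rewrite mem_head.
by apply: IH => i si; apply: fl; rewrite inE si orbT.
Qed.

Section Intertwining.
Variables (R : realType) (n : nat) (a : 'I_n -> R).
Hypothesis a_gt0 : forall i, 0 < a i.
Local Notation w := (weight a).

Definition clock_rate (i : 'I_n * bool) : R := if i.2 then (a i.1)^-1 else a i.1.

Lemma clock_rate_gt0 i : 0 < clock_rate i.
Proof. by rewrite /clock_rate; case: i.2; rewrite ?invr_gt0. Qed.

Lemma sum_clock_rate : \sum_i clock_rate i = \sum_(i < n) (a i + (a i)^-1).
Proof.
rewrite -(pair_bigA _ (fun l b => clock_rate (l, b))) /=.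
by apply: eq_bigr => l _; rewrite big_bool addrC.
Qed.

Lemma berele_rateE x y : berele_rate a x y =
  \sum_i clock_rate i * ((y == clock_step i x)%:R - (y == x)%:R).
Proof.
rewrite -(pair_bigA _ (fun l b => clock_rate (l, b) *
  ((y == clock_step (l, b) x)%:R - (y == x)%:R))) /=.
apply: eq_bigr => l _; rewrite big_bool addrC /clock_rate /=.
by rewrite -!val_eqE /= /clock_index /= addn0 addn1.
Qed.

Lemma weight_gt0 x : 0 < w x.
Proof. by apply: prodr_gt0 => i _; rewrite exprz_gt0. Qed.

Lemma weight_clock_step i x : w (clock_step i x) = clock_rate i * w x.
Proof.
case: i => l b; rewrite /weight.
have -> : clock_rate (l, b) =
    \prod_(i < n) a i ^ ((clock_index (l, b) == i.*2.+1)%:Z - (clock_index (l, b) == i.*2.+2)%:Z).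
  rewrite (bigD1 l) //= big1 ?mulr1.
    rewrite /clock_index /=; case: b; rewrite ?addn1 ?addn0.
      by rewrite eqxx (_ : _ == _ = false) ?sub0r; [|lia].
    by rewrite eqxx (_ : _ == _ = false) ?subr0; [|lia].
  move=> i /negbTE il; rewrite (_ : _ == _ = false).
    rewrite (_ : _ == _ = false) ?subrr // /clock_index /=.
    by move: il; rewrite -val_eqE /=; case: b; lia.
  by rewrite /clock_index /=; move: il; rewrite -val_eqE /=; case: b; lia.
rewrite -big_split; apply: eq_bigr => i _ /=.
rewrite -expfzDr; last by rewrite gt_eqF.
congr (a i ^ _).
have := clock_ring_exponents (valP x) (clock_index_bound (l, b)) (ltn_ord i).
by move=> /= H; lia.
Qed.

(** Up to the factor [symplectic_schur a z], the integral of [f] against the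
    Gibbs law; keeping it unnormalised avoids ratios of Schur functions. *)
Definition weighted_sum (f : pattern n -> R) (z : weyl n) : R :=
  \sum_(x <- fibre z) w x * f x.

Definition neighbours (z : weyl n) : seq (weyl n) :=
  undup [seq bottom_row (clock_step i x) | x <- fibre z, i <- enum {: 'I_n * bool}].

Lemma mem_neighbours z y : (y \in neighbours z) = neighbour z y.
Proof.
rewrite mem_undup; apply/allpairsP/idP.
  by move=> [[x i] [/=]]; rewrite mem_fibre => /eqP <- _ ->; exact: clock_step_bottom.
move=> zy; have [u uy] := fibre_nonempty y; rewrite -uy in zy *.
have [i [x [xz <-]]] := clock_step_onto zy.
by exists (x, i); rewrite mem_fibre mem_enum xz eqxx.
Qed.

(** Berele's bijection between patterns over [z] with a clock and patterns over
    the neighbours of [z]. *)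
Lemma perm_clock_step z :
  perm_eq [seq clock_step i x | x <- fibre z, i <- enum {: 'I_n * bool}]
          (flatten [seq fibre y | y <- neighbours z]).
Proof.
apply: uniq_perm.
- rewrite allpairs_uniq ?fibre_uniq ?enum_uniq // => -[x i] [y j] /=.
  move=> /allpairsP[[x' i'] [/= xz _ [-> _]]] /allpairsP[[y' j'] [/= yz _ [-> _]]].
  move: xz yz; rewrite !mem_fibre => /eqP xz /eqP yz.
  by move/(clock_step_inj (etrans xz (esym yz))) => [-> ->].
- have : uniq (neighbours z) by exact: undup_uniq.
  elim: (neighbours z) => //= y s IH /andP[ys us].
  rewrite cat_uniq fibre_uniq IH // andbT /=; apply/hasPn => x.
  move=> /flatten_mapP[y' y's]; rewrite !mem_fibre => /eqP xy'.
  by apply: contra ys => /eqP <-; rewrite xy'.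
move=> u; apply/allpairsP/flatten_mapP.
  move=> [[x i] [/=]]; rewrite mem_fibre => /eqP xz _ ->.
  exists (bottom_row (clock_step i x)); last by rewrite mem_fibre.
  by rewrite mem_neighbours -xz; exact: clock_step_bottom.
move=> [y yz]; rewrite mem_fibre => /eqP uy; rewrite mem_neighbours -uy in yz.
have [i [x [xz <-]]] := clock_step_onto yz.
by exists (x, i); rewrite mem_fibre mem_enum xz eqxx.
Qed.

(** The relation M q = Q M, up to the diagonal terms: the rate of a clock is
    absorbed in the weight of the new pattern, and the sum is reindexed by
    [perm_clock_step]. *)
Lemma weighted_sum_generator f z :
  weighted_sum (fun x => \sum_i clock_rate i * f (clock_step i x)) z =
  \sum_(y <- neighbours z) weighted_sum f y.
Proof.
transitivity (\sum_(x <- fibre z) \sum_(i <- enum {: 'I_n * bool})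
    w (clock_step i x) * f (clock_step i x)).
  apply: eq_bigr => x _; rewrite big_enum /= mulr_sumr.
  by apply: eq_bigr => i _; rewrite weight_clock_step mulrCA mulrA.
rewrite -(big_allpairs_dep (h := fun x i => clock_step i x)
  (r2 := fun=> enum {: 'I_n * bool}) (F := fun u => w u * f u)).
by rewrite (perm_big _ (perm_clock_step z)) /= big_flatten big_map.
Qed.

Lemma weighted_sumZ f k z :
  weighted_sum (fun x => k * f x) z = k * weighted_sum f z.
Proof. by rewrite /weighted_sum mulr_sumr; apply: eq_bigr => x _; rewrite mulrCA. Qed.

(** By [weighted_sum_generator] the weighted sums of an Euler step depend on [f]
    only through its weighted sums, so proportionality is preserved. *)
Lemma weighted_sum_euler f g (k l h : R) N :
  (forall z, weighted_sum f z * k = weighted_sum g z * l) ->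
  forall z, weighted_sum (euler clock_rate (@clock_step n) N h f) z * k =
            weighted_sum (euler clock_rate (@clock_step n) N h g) z * l.
Proof.
rewrite /euler => fg; elim: N => [|N IH] z //=.
have step (F : pattern n -> R) : weighted_sum (euler_step clock_rate (@clock_step n) h F) z =
    weighted_sum F z + h * \sum_(y <- neighbours z) weighted_sum F y.
  rewrite -weighted_sum_generator -weighted_sumZ -big_split /=.
  by apply: eq_bigr => x _; rewrite -mulrDr.
rewrite !step !mulrDl.
rewrite IH -!mulrA; congr (_ + h * _); rewrite !mulr_suml.
by apply: eq_bigr => y _; exact: IH.
Qed.

Variable p : R -> pattern n -> pattern n -> R.
Hypothesis tp : transition_function p.
Hypothesis rate_p : has_rate_matrix p (berele_rate a).

(** Started from a Gibbs law, the pattern at time [t] charges patterns with the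
    same bottom row proportionally to their weights.  For Euler products this is
    [weighted_sum_euler] applied to the indicators of [u] and [v]. *)
Lemma intertwining_weight t z u v : 0 <= t -> bottom_row u = bottom_row v ->
  weighted_sum (fun x => p t x u) z * w v = weighted_sum (fun x => p t x v) z * w u.
Proof.
move=> t0 uv.
have rate_p' : has_rate_matrix p (fun x y : pattern n =>
    \sum_i clock_rate i * ((y == clock_step i x)%:R - (y == x)%:R)).
  by move=> x y; rewrite -berele_rateE; exact: rate_p.
have r0 i : 0 <= clock_rate i by rewrite ltW ?clock_rate_gt0.
pose E y N := weighted_sum (euler clock_rate (@clock_step n) N.+1 (t / N.+1%:R)
  (fun x => (x == y)%:R)) z.
pose C := expR ((\sum_i clock_rate i) * t).
have cvgE y : E y N @[N --> \oo] --> C * weighted_sum (fun x => p t x y) z.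
  rewrite -weighted_sumZ /E /weighted_sum; apply: cvg_sum_seq => x _.
  apply: cvgM; first exact: cvg_cst.
  exact: (euler_cvg_transition r0 tp rate_p').
have deltaE y y' : weighted_sum (fun x => (x == y)%:R) y' =
    (bottom_row y == y')%:R * w y.
  rewrite /weighted_sum; case: (boolP (bottom_row y == y')) => yy'.
    rewrite mul1r; under eq_bigr do rewrite mulrC.
    by rewrite sum_pick ?fibre_uniq // mem_fibre.
  rewrite mul0r big_seq big1 // => x; rewrite mem_fibre => /eqP xy'.
  by case: eqP => [xy|_]; [rewrite -xy xy' eqxx in yy'|rewrite mulr0].
have : (fun N => E u N * w v) = (fun N => E v N * w u).
  apply/funext => N; apply: weighted_sum_euler => y.
  by rewrite !deltaE uv mulrAC.
move=> EE.
have h1 : E u N * w v @[N --> \oo] --> C * weighted_sum (fun x => p t x u) z * w v.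
  by apply: cvgM; [exact: cvgE|exact: cvg_cst].
have h2 : E v N * w u @[N --> \oo] --> C * weighted_sum (fun x => p t x v) z * w u.
  by apply: cvgM; [exact: cvgE|exact: cvg_cst].
rewrite EE in h1; have CC := cvg_unique (@Rhausdorff R) h1 h2.
have C0 : C != 0 by rewrite lt0r_neq0 // expR_gt0.
by apply: (mulfI C0); rewrite !mulrA; exact: CC.
Qed.
End Intertwining.

(** * The projected semigroup *)
Lemma esum_fibre (R : realType) n (f : pattern n -> R) : (forall x, 0 <= f x) ->
  (\esum_(x in [set: pattern n]) (f x)%:E =
   \esum_(y in [set: weyl n]) (\sum_(x <- fibre y) f x)%:E)%E.
Proof.
move=> f0.
transitivity (\esum_(y in [set: weyl n])
    \esum_(x in [set x : pattern n | bottom_row x = y]) (f x)%:E)%E; last first.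
  apply: eq_esum => y _; rewrite esum_fset; last by move=> *; rewrite lee_fin.
    by rewrite fsbig_finite ?sumEFin //; exact: finite_fibre.
  exact: finite_fibre.
rewrite esum_esum; last by move=> *; rewrite lee_fin.
apply: esym; apply: (reindex_esum _ _ (fun x => (bottom_row x, x))
  (fun k => (f k.2)%:E)); split.
- by move=> x _ /=.
- by move=> x y _ _ [].
- by move=> [y x] /= [_ <-]; exists x.
Qed.

Section Projection.
Variables (R : realType) (n : nat) (a : 'I_n -> R).
Hypothesis a_gt0 : forall i, 0 < a i.
Local Notation w := (weight a).
Local Notation Sp := (symplectic_schur a).

Lemma symplectic_schurE z : Sp z = \sum_(x <- fibre z) w x.
Proof. by rewrite /symplectic_schur fsbig_finite //; exact: finite_fibre. Qed.

Lemma symplectic_schur_gt0 z : 0 < Sp z.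
Proof.
have [x xz] := fibre_nonempty z; rewrite symplectic_schurE.
rewrite (bigD1_seq x) ?fibre_uniq ?mem_fibre ?xz //=.
rewrite ltr_wpDr ?weight_gt0 // sumr_ge0 // => u _.
by rewrite ltW ?weight_gt0.
Qed.

Lemma gibbs_fibre x z : bottom_row x = z -> gibbs a x z = w x / Sp z.
Proof. by move=> xz; rewrite /gibbs xz eqxx. Qed.

Lemma gibbs_ge0 x z : 0 <= gibbs a x z.
Proof.
rewrite /gibbs; case: ifP => // _.
by rewrite divr_ge0 // ltW ?weight_gt0 ?symplectic_schur_gt0.
Qed.

Lemma sum_gibbs f z :
  \sum_(x <- fibre z) gibbs a x z * f x = weighted_sum a f z / Sp z.
Proof.
rewrite /weighted_sum mulr_suml; apply: eq_big_seq => x.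
by rewrite mem_fibre => /eqP /gibbs_fibre ->; rewrite mulrAC.
Qed.

Lemma sum_gibbs1 z : \sum_(x <- fibre z) gibbs a x z = 1.
Proof.
under eq_bigr do rewrite -[gibbs _ _ _]mulr1.
rewrite sum_gibbs /weighted_sum; under eq_bigr do rewrite mulr1.
by rewrite -symplectic_schurE divff // lt0r_neq0 // symplectic_schur_gt0.
Qed.

Variable p : R -> pattern n -> pattern n -> R.
Hypothesis tp : transition_function p.
Hypothesis rate_p : has_rate_matrix p (berele_rate a).

(** The kernel pbar_t = M p_t Phi, with Phi the projection to the bottom row. *)
Definition projected (t : R) (z y : weyl n) : R :=
  \sum_(x <- fibre z) gibbs a x z * \sum_(u <- fibre y) p t x u.

(** The relation M p_t = pbar_t M. *)
Lemma intertwining t z u : 0 <= t ->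
  \sum_(x <- fibre z) gibbs a x z * p t x u =
  projected t z (bottom_row u) * gibbs a u (bottom_row u).
Proof.
move=> t0; set y := bottom_row u.
have yE : projected t z y = \sum_(v <- fibre y) \sum_(x <- fibre z) gibbs a x z * p t x v.
  by rewrite exchange_big /=; apply: eq_bigr => x _; rewrite mulr_sumr.
have Sy := lt0r_neq0 (symplectic_schur_gt0 y).
have Sz := lt0r_neq0 (symplectic_schur_gt0 z).
rewrite gibbs_fibre // mulrA; apply/(canRL (mulfK Sy)).
rewrite sum_gibbs yE; set W := weighted_sum a _ z.
rewrite [Sp y]symplectic_schurE mulr_sumr [RHS]mulr_suml.
apply: eq_big_seq => v; rewrite mem_fibre => /eqP vy.
rewrite sum_gibbs mulrAC [RHS]mulrAC {}/W.
by congr (_ / _); apply: intertwining_weight.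
Qed.

(** The semigroup property is M p_s p_t Phi = pbar_s M p_t Phi, with the sum over
    intermediate patterns cut along the fibres. *)
Lemma projected_transition : transition_function projected.
Proof.
have p0 t x u : 0 <= t -> 0 <= p t x u by exact: (transition_ge0 tp).
have s0 t x y : 0 <= t -> 0 <= \sum_(u <- fibre y) p t x u.
  by move=> t0; rewrite sumr_ge0 // => u _; exact: p0.
split.
- by move=> t z y t0; rewrite sumr_ge0 // => x _; rewrite mulr_ge0 ?gibbs_ge0 ?s0.
- move=> t z t0; rewrite /projected; under eq_esum do rewrite -sumEFin.
  rewrite esum_sum; last by move=> *; rewrite lee_fin mulr_ge0 ?gibbs_ge0 ?s0.
  under eq_bigr => x _.
    under eq_esum do rewrite EFinM.
    rewrite esumZl ?gibbs_ge0 //; last by move=> *; rewrite lee_fin s0.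
    rewrite -(@esum_fibre _ _ (p t x)) ?(transition_sum1 tp) // ?mule1; last by move=> u; exact: p0.
    over.
  by rewrite sumEFin sum_gibbs1.
- move=> z y; transitivity (\sum_(x <- fibre z) gibbs a x z * (z == y)%:R : R); last first.
    by rewrite -mulr_suml sum_gibbs1 mul1r.
  apply: eq_big_seq => x; rewrite mem_fibre => /eqP xz; congr (_ * _).
  under eq_bigr => u _ do rewrite (transition_0 tp) eq_sym -[_%:R]mulr1.
  have [zy|zy] := eqVneq z y; last first.
    rewrite big_seq big1 // => u; rewrite mem_fibre => /eqP uy.
    by rewrite mulr1; case: eqP => // ux; rewrite -uy ux xz eqxx in zy.
  by rewrite sum_pick ?fibre_uniq ?mem_fibre ?xz ?zy ?eqxx.
move=> s t z y s0' t0.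
transitivity (\esum_(u in [set: pattern n])
    ((\sum_(x <- fibre z) gibbs a x z * p s x u) * \sum_(v <- fibre y) p t u v)%:E)%E.
  rewrite /projected -sumEFin.
  under eq_bigr => x _.
    rewrite EFinM -sumEFin; under eq_bigr do rewrite (transition_semigroup tp) //.
    rewrite -esum_sum; last by move=> *; rewrite lee_fin mulr_ge0 ?p0.
    under eq_esum do rewrite sumEFin -mulr_sumr.
    rewrite -esumZl ?gibbs_ge0 //; last by move=> *; rewrite lee_fin mulr_ge0 ?s0 ?p0.
    under eq_esum do rewrite -EFinM.
    over.
  rewrite -esum_sum; last by move=> *; rewrite lee_fin !mulr_ge0 ?gibbs_ge0 ?s0 ?p0.
  apply: eq_esum => u _; rewrite sumEFin mulr_suml; congr EFin.
  by apply: eq_bigr => x _; rewrite mulrA.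
rewrite esum_fibre; last first.
  move=> u; rewrite mulr_ge0 ?s0 // sumr_ge0 // => x _.
  by rewrite mulr_ge0 ?gibbs_ge0 ?p0.
apply: eq_esum => v _; congr EFin; rewrite [projected t v y]/projected mulr_sumr.
apply: eq_big_seq => u; rewrite mem_fibre => /eqP uv.
by rewrite intertwining // uv mulrA.
Qed.

(** Fibres are finite, so the derivative at 0 is taken term by term; it is
    M q Phi, and [weighted_sum_generator] identifies it with [weyl_rate]. *)
Lemma projected_rate : has_rate_matrix projected (weyl_rate a).
Proof.
move=> z y.
have -> : weyl_rate a z y =
    \sum_(x <- fibre z) gibbs a x z * \sum_(u <- fibre y) berele_rate a x u.
  under eq_big_seq => x.
    rewrite mem_fibre => /eqP xz.
    under eq_bigr do rewrite berele_rateE; rewrite exchange_big /=.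
    under eq_bigr => i _.
      rewrite -mulr_sumr sumrB.
      have pick v : \sum_(u <- fibre y) (u == v)%:R = (bottom_row v == y)%:R :> R.
        under eq_bigr do rewrite -[_%:R]mulr1.
        have [vy|vy] := eqVneq (bottom_row v) y.
          by rewrite sum_pick ?fibre_uniq // mem_fibre vy.
        rewrite big_seq big1 // => u; rewrite mem_fibre => /eqP uy; rewrite mulr1.
        by case: eqP => // uv; rewrite -uy uv eqxx in vy.
      rewrite !pick xz mulrBr; over.
    rewrite sumrB -mulr_suml mulrBr; over.
  rewrite sumrB -mulr_suml sum_gibbs1 mul1r sum_gibbs.
  rewrite (weighted_sum_generator a_gt0 (fun x => (bottom_row x == y)%:R)).
  have -> : \sum_(y' <- neighbours z) weighted_sum a (fun x => (bottom_row x == y)%:R) y'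
      = (neighbour z y)%:R * Sp y.
    have part y' : weighted_sum a (fun x => (bottom_row x == y)%:R) y' = (y' == y)%:R * Sp y.
      rewrite /weighted_sum symplectic_schurE; have [<-|yy'] := eqVneq y' y.
        rewrite mul1r; apply: eq_big_seq => x; rewrite mem_fibre => /eqP ->.
        by rewrite eqxx mulr1.
      rewrite mul0r big_seq big1 // => x; rewrite mem_fibre => /eqP ->.
      by rewrite (negbTE yy') mulr0.
    under eq_bigr do rewrite part; rewrite -mem_neighbours.
    have [yz|yz] := boolP (y \in neighbours z).
      by rewrite (sum_pick (fun=> Sp y)) ?undup_uniq // mul1r.
    rewrite mul0r big_seq big1 // => y' y'z; case: eqP => [yy|]; last by rewrite mul0r.
    by rewrite -yy y'z in yz.
  rewrite /weyl_rate -/(neighbour z y) [z == y]eq_sym; have [->|_] := eqVneq y z.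
    by rewrite neighbour_irrefl !mul0r sub0r mulr1 sum_clock_rate.
  by rewrite mulr0 subr0; case: ifP; rewrite ?mul1r ?mul0r.
have -> : (fun h => (projected h z y - (z == y)%:R) / h) =
    (fun h => \sum_(x <- fibre z) gibbs a x z *
       \sum_(u <- fibre y) (p h x u - (x == u)%:R) / h).
  apply/funext => h; rewrite -(transition_0 projected_transition z y) /projected.
  rewrite -sumrB mulr_suml; apply: eq_bigr => x _.
  rewrite -mulrBr -mulrA -sumrB mulr_suml; congr (_ * _); apply: eq_bigr => u _.
  by rewrite (transition_0 tp).
apply: cvg_sum_seq => x _; apply: cvgM; first exact: cvg_cst.
by apply: cvg_sum_seq => u _; exact: rate_p.
Qed.
End Projection.

(** * Events determined by finitely many discrete variables *)
Section DiscreteEvents.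
Context (R : realType) {d : measure_display} {T : measurableType d}.
Variable P : probability T R.

Lemma measurable_forall_le m (D : nat -> T -> Prop) :
  (forall i, (i <= m)%N -> measurable [set w | D i w]) ->
  measurable [set w | forall i, (i <= m)%N -> D i w].
Proof.
move=> mD; rewrite (_ : [set w | _] = \bigcap_(i in `I_m.+1) [set w | D i w]).
  by apply: bigcap_measurable => [|i]; [exists 0%N|rewrite /= ltnS; exact: mD].
by apply/seteqP; split => w /= H i; have := H i; rewrite /= ltnS.
Qed.

Lemma probability_split (S : choiceType) (A : set T) (Y : T -> S) (s : seq S) :
  measurable A -> uniq s -> {in s, forall x, measurable [set w | Y w = x]} ->
  P (A `&` [set w | Y w \in s]) =
  (\sum_(x <- s) P (A `&` [set w | Y w = x]))%E.
Proof.
move=> mA; elim: s => [|x s IH] /= us mY.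
  by rewrite big_nil (_ : _ `&` _ = set0) ?measure0 // -subset0 => w [].
have {us} [xs us] := andP us.
have mx : measurable (A `&` [set w | Y w = x]).
  by apply: measurableI => //; apply: mY; rewrite mem_head.
have mYs : {in s, forall x, measurable [set w | Y w = x]}.
  by move=> y ys; apply: mY; rewrite inE ys orbT.
have ms : measurable (A `&` [set w | Y w \in s]).
  rewrite (_ : [set w | Y w \in s] = \big[setU/set0]_(y <- s) [set w | Y w = y]).
    apply: measurableI => //; rewrite big_seq; exact: bigsetU_measurable.
  apply/seteqP; split=> w /=; rewrite -bigcup_seq; last by move=> [y /= ys ->].
  by move=> Ys; exists (Y w).
rewrite big_cons -IH // -measureU //.
  congr (P _); apply/seteqP; split=> [w [Aw]|w [[Aw]|[Aw]]] /=.
  - by rewrite inE => /predU1P[->|Ys]; [left|right].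
  - by move=> ->; rewrite mem_head.
  - by move=> Ys; rewrite inE Ys orbT.
by rewrite -subset0 => w [[_ /= Yx] [_ /=]]; rewrite Yx (negbTE xs).
Qed.

Lemma probability_setI1 (A C : set T) : measurable A -> measurable C ->
  P A = 1%E -> P (A `&` C) = P C.
Proof.
move=> mA mC PA; have mCA : measurable (C `&` ~` A).
  by apply: measurableI => //; exact: measurableC.
rewrite setIC -[in RHS](setIT C) -(setUv A) setIUr measureU //; last 2 first.
- exact: measurableI.
- by rewrite -subset0 => w [[_ Aw] [_ /(_ Aw)]].
rewrite [X in _ = (_ + X)%E](_ : _ = 0%E) ?adde0 //.
apply/eqP; rewrite eq_le measure_ge0 andbT.
have -> : (0 = P (~` A))%E by rewrite probability_setC // PA subee.
by apply: le_measure; rewrite ?inE; [exact: mCA|exact: measurableC|exact: subIsetr].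
Qed.
End DiscreteEvents.

(** * The process of bottom rows *)
Section BottomRowProcess.
Variables (R : realType) (n : nat) (a : 'I_n -> R) (z : weyl n).
Context {d : measure_display} {T : measurableType d}.
Variables (P : probability T R) (Z : R -> T -> pattern n).
Hypothesis a_gt0 : forall i, 0 < a i.
Hypothesis mZ : forall (t : R) x, 0 <= t -> measurable [set w | Z t w = x].
Variable p : R -> pattern n -> pattern n -> R.
Hypothesis tp : transition_function p.
Hypothesis rate_p : has_rate_matrix p (berele_rate a).
Hypothesis fdd : forall (m : nat) (t : nat -> R) (x : nat -> pattern n),
  t 0%N = 0 -> (forall i, (i < m)%N -> t i <= t i.+1) ->
  P [set w | forall i, (i <= m)%N -> Z (t i) w = x i] =
  (gibbs a (x 0%N) z * \prod_(i < m) p (t i.+1 - t i) (x i) (x i.+1))%:E.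

Local Notation B t w := (bottom_row (Z t w)).
Local Notation pbar := (projected a p).

Lemma measurable_bottom_row (t : R) y : 0 <= t -> measurable [set w | B t w = y].
Proof.
move=> t0; rewrite (_ : [set w | _] =
  \big[setU/set0]_(x <- fibre y) [set w | Z t w = x]).
  by apply: bigsetU_measurable => x _; exact: mZ.
apply/seteqP; split=> w /=; rewrite -bigcup_seq.
  by move=> By; exists (Z t w) => //=; rewrite mem_fibre By.
by move=> [x /=]; rewrite mem_fibre => /eqP <- ->.
Qed.

Definition path_mass (m : nat) (t : nat -> R) (y : nat -> weyl n) : R :=
  (y 0%N == z)%:R * \prod_(i < m) pbar (t i.+1 - t i) (y i) (y i.+1).

Lemma monotone_ge0 m (t : nat -> R) : t 0%N = 0 ->
  (forall i, (i < m)%N -> t i <= t i.+1) -> forall i, (i <= m)%N -> 0 <= t i.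
Proof.
move=> t0 tm; elim=> [_|i IH im]; first by rewrite t0.
by apply: le_trans (tm i im); apply: IH; exact: ltnW.
Qed.

(** The law of the bottom rows before time [t j] and of the whole patterns from
    then on.  The induction on [j] sums the pattern at time [t j] over its
    fibre: by [intertwining] this replaces the Gibbs law at time [t j] by the
    Gibbs law at time [t j.+1] times a factor [projected]. *)
Lemma mixed_path_law m (t : nat -> R) (y : nat -> weyl n) j (x : nat -> pattern n) :
  t 0%N = 0 -> (forall i, (i < m)%N -> t i <= t i.+1) -> (j <= m)%N ->
  bottom_row (x j) = y j ->
  P [set w | forall i, (i <= m)%N ->
       if (i < j)%N then B (t i) w = y i else Z (t i) w = x i] =
  (path_mass j t y * gibbs a (x j) (y j) *
   \prod_(j <= i < m) p (t i.+1 - t i) (x i) (x i.+1))%:E.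
Proof.
move=> t0 tm; have tge0 := monotone_ge0 t0 tm.
elim: j x => [|j IH] x jm xy.
  rewrite /path_mass big_ord0 mulr1 big_mkord fdd //; congr EFin; congr (_ * _).
  by rewrite /gibbs xy eqxx; case: ifP; rewrite ?mul1r ?mul0r // => /eqP ->.
(* [A] leaves the pattern at time [t j] free. *)
pose D i w := if i == j then True
  else if (i < j)%N then B (t i) w = y i else Z (t i) w = x i.
pose A := [set w | forall i, (i <= m)%N -> D i w].
have mA : measurable A.
  apply: measurable_forall_le => i im; rewrite /D; case: eqP => _.
    by rewrite (_ : [set _ | _] = setT) //; apply/seteqP.
  by case: (i < j)%N; [apply: measurable_bottom_row|apply: mZ]; exact: tge0.
have -> : [set w | forall i, (i <= m)%N ->
       if (i < j.+1)%N then B (t i) w = y i else Z (t i) w = x i] =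
    A `&` [set w | Z (t j) w \in fibre (y j)].
  apply/seteqP; split=> [w H|w [H]] /=.
    split; last by rewrite mem_fibre; have /= := H j (ltnW jm); rewrite ltnSn => ->.
    move=> i im; have := H i im; rewrite /D [(i < j.+1)%N]ltnS [(i <= j)%N]leq_eqVlt.
    by case: (eqVneq i j).
  rewrite mem_fibre => /eqP Bj i im; have := H i im.
  rewrite /D [(i < j.+1)%N]ltnS [(i <= j)%N]leq_eqVlt.
  by case: (eqVneq i j) => [-> _|] /=.
rewrite probability_split ?fibre_uniq //; last by move=> v _; apply: mZ; apply: tge0; exact: ltnW.
pose x' v i := if i == j then v else x i.
have split_law v : v \in fibre (y j) -> P (A `&` [set w | Z (t j) w = v]) =
    (path_mass j t y * gibbs a v (y j) * (p (t j.+1 - t j) v (x j.+1) *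
     \prod_(j.+1 <= i < m) p (t i.+1 - t i) (x i) (x i.+1)))%:E.
  rewrite mem_fibre => /eqP vy.
  have := IH (x' v) (ltnW jm); rewrite {1}/x' eqxx => /(_ vy).
  rewrite {2}/x' eqxx big_ltn // {2 3}/x' eqxx gtn_eqF //.
  rewrite (eq_big_nat _ _ (F2 := fun i => p (t i.+1 - t i) (x i) (x i.+1))); last first.
    by move=> i /andP[ji _]; rewrite /x' !gtn_eqF // ltnW.
  move=> <-; congr (P _); apply/seteqP; split=> [w [H Zj]|w H] /=.
    move=> i im; have := H i im; rewrite /D /x'.
    by case: (eqVneq i j) => [-> _|//]; rewrite ltnn.
  split=> [i im|]; last by have := H j (ltnW jm); rewrite /= ltnn /x' eqxx.
  by have := H i im; rewrite /D /x'; case: (eqVneq i j).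
rewrite (eq_big_seq _ split_law) sumEFin; congr EFin.
transitivity (\sum_(v <- fibre (y j)) path_mass j t y *
    (gibbs a v (y j) * p (t j.+1 - t j) v (x j.+1)) *
    \prod_(j.+1 <= i < m) p (t i.+1 - t i) (x i) (x i.+1)).
  by apply: eq_bigr => v _; rewrite !mulrA.
rewrite -mulr_suml -mulr_sumr; congr (_ * _).
rewrite (intertwining a_gt0 tp rate_p) ?subr_ge0 ?tm // xy mulrA.
by rewrite /path_mass big_ord_recr /= mulrA.
Qed.

Lemma path_pattern_law m (t : nat -> R) (y : nat -> weyl n) x :
  t 0%N = 0 -> (forall i, (i < m)%N -> t i <= t i.+1) -> bottom_row x = y m ->
  P ([set w | forall i, (i <= m)%N -> B (t i) w = y i] `&`
     [set w | Z (t m) w = x]) = (path_mass m t y * gibbs a x (y m))%:E.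
Proof.
move=> t0 tm xy.
have := @mixed_path_law m t y m (fun=> x) t0 tm (leqnn m) xy.
rewrite big_geq // mulr1 => <-; congr (P _); apply/seteqP; split=> [w [H Zx]|w H] /=.
  by move=> i im; case: ltnP => mi; [exact: H|rewrite (_ : i = m) //; lia].
have Zx : Z (t m) w = x by have := H m (leqnn m); rewrite ltnn.
split=> // i im; have := H i im; case: ltnP => // mi _.
by rewrite (_ : i = m) ?Zx //; lia.
Qed.

Lemma path_law m (t : nat -> R) (y : nat -> weyl n) :
  t 0%N = 0 -> (forall i, (i < m)%N -> t i <= t i.+1) ->
  P [set w | forall i, (i <= m)%N -> B (t i) w = y i] = (path_mass m t y)%:E.
Proof.
move=> t0 tm; have tge0 := monotone_ge0 t0 tm.
have mA : measurable [set w | forall i, (i <= m)%N -> B (t i) w = y i].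
  by apply: measurable_forall_le => i im; apply: measurable_bottom_row; exact: tge0.
rewrite -[path_mass _ _ _]mulr1 -(sum_gibbs1 a_gt0 (y m)) mulr_sumr -sumEFin.
under eq_big_seq => x.
  rewrite mem_fibre => /eqP xy; rewrite -path_pattern_law //; over.
rewrite -probability_split ?fibre_uniq //; last by move=> v _; apply: mZ; exact: tge0.
congr (P _); apply/seteqP; split=> [w H|w []//].
by split=> //=; rewrite mem_fibre H.
Qed.

(** Observations of the bottom row at finitely many times, in any order and
    possibly contradictory, so that these events are stable by intersection. *)
Definition cylinder (l : seq (R * weyl n)) : set T :=
  [set w | {in l, forall q, B q.1 w = q.2}].

Lemma measurable_cylinder l : {in l, forall q, 0 <= q.1} -> measurable (cylinder l).
Proof.
elim: l => [|q l IH] ql.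
  by rewrite (_ : cylinder _ = setT) //; apply/seteqP; split.
have -> : cylinder (q :: l) = [set w | B q.1 w = q.2] `&` cylinder l.
  apply/seteqP; split=> [w H|w [Bq H]] /=.
    by split=> [|r rl]; apply: H; rewrite inE ?eqxx ?rl ?orbT.
  by move=> r; rewrite inE => /predU1P[->|/H].
apply: measurableI.
  by apply: measurable_bottom_row; apply: ql; rewrite mem_head.
by apply: IH => r rl; apply: ql; rewrite inE rl orbT.
Qed.

(** After sorting the observation times this is the comparison of
    [path_pattern_law] with [path_law]. *)
Lemma cylinder_law l t x : {in l, forall q, 0 <= q.1 <= t} -> 0 <= t ->
  P (cylinder l `&` [set w | Z t w = x]) =
  ((gibbs a x (bottom_row x))%:E *
   P (cylinder l `&` [set w | B t w = bottom_row x]))%E.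
Proof.
move=> lt t0; pose l' := sort (relpre fst <=%R) l.
have l'E : l' =i l by move=> q; rewrite mem_sort.
have sl' : sorted (relpre fst <=%R) l' by apply: sort_sorted => q r; exact: le_total.
(* Paths have to start at time 0, where the bottom row is [z] almost surely. *)
pose qs := rcons ((0, z) :: l') (t, bottom_row x).
pose m := (size l').+1.
pose ts i := (nth (0, z) qs i).1; pose ys i := (nth (0, z) qs i).2.
have szq : size qs = m.+1 by rewrite size_rcons.
have tsm : ts m = t by rewrite /ts nth_rcons ltnn eqxx.
have ysm : ys m = bottom_row x by rewrite /ys nth_rcons ltnn eqxx.
have lt' : {in l', forall q, 0 <= q.1 <= t} by move=> q; rewrite l'E; exact: lt.
have ts_mono i : (i < m)%N -> ts i <= ts i.+1.
  have : sorted (relpre fst <=%R) qs.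
    rewrite /qs /= rcons_path /=; apply/andP; split.
      rewrite path_sortedE ?sl' ?andbT; last first.
        by move=> q r s; exact: le_trans.
      by apply/allP => q /lt' /andP[].
    have := mem_last (0, z) l'; rewrite inE => /predU1P[->//|/lt' /andP[]//].
  by move=> /(sortedP (0, z)) H im; apply: H; rewrite szq ltnS.
have ts0 : ts 0%N = 0 by [].
have pathE : [set w | forall i, (i <= m)%N -> B (ts i) w = ys i] =
    [set w | B 0 w = z] `&` (cylinder l `&` [set w | B t w = bottom_row x]).
  apply/seteqP; split=> [w H|w [B0 [Bl Bt]]] /=.
    split; first by have := H 0%N isT.
    split; last by have := H m (leqnn m); rewrite tsm ysm.
    move=> q; rewrite -l'E => ql.
    have iq : (index q l' < size l')%N by rewrite index_mem.
    have := H (index q l').+1; rewrite /ts /ys nth_rcons /= ltnS iq nth_index //.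
    by apply; rewrite /m; lia.
  move=> i im; have := mem_nth (0, z) (_ : (i < size qs)%N).
  rewrite szq ltnS => /(_ im); rewrite -/(ts i) -/(ys i).
  rewrite /qs mem_rcons !inE => /or3P[/eqP e|/eqP e|].
  - by rewrite /ts /ys e.
  - by rewrite /ts /ys e.
  - by rewrite l'E => /Bl.
have m0 : measurable [set w | B 0 w = z] by exact: measurable_bottom_row.
have mC : measurable (cylinder l) by apply: measurable_cylinder => q /lt /andP[].
have P0 : P [set w | B 0 w = z] = 1%E.
  have := @path_law 0%N (fun=> 0) (fun=> z) erefl (fun _ => ltac:(by [])).
  rewrite /path_mass big_ord0 eqxx mulr1 => <-; congr (P _).
  apply/seteqP; split=> [w H i //|w H]; exact: (H 0%N).
have mt : measurable [set w | B t w = bottom_row x] by exact: measurable_bottom_row.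
have lawB := path_law ys ts0 ts_mono.
rewrite pathE probability_setI1 // in lawB; last exact: measurableI.
have := path_pattern_law ts0 ts_mono (esym ysm).
rewrite pathE tsm -!setIA (_ : _ `&` [set w | Z t w = x] = [set w | Z t w = x]).
  rewrite probability_setI1 //; last by apply: measurableI => //; exact: mZ.
  by rewrite ysm lawB mulrC EFinM.
by apply/seteqP; split=> [w []//|w Zx]; split=> //=; rewrite Zx.
Qed.

(** Both sides are finite measures in [A] which agree on the cylinders with times
    in [0, t]; these are stable by intersection and generate the past. *)
Lemma past_law t x A : 0 <= t -> past (fun s w => B s w) t A ->
  measurable A /\
  P (A `&` [set w | Z t w = x]) = ((gibbs a x (bottom_row x))%:E *
   P (A `&` [set w | B t w = bottom_row x]))%E.
Proof.
move=> t0 FA.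
have ge0 s : 0 <= s <= t -> 0 <= s by case/andP.
split.
  move: A FA; apply: smallest_sub; first exact: sigma_algebra_measurable.
  by move=> _ [s [y [s0 _ ->]]]; exact: measurable_bottom_row.
pose G := [set A | exists2 l, {in l, forall q, 0 <= q.1 <= t} & A = cylinder l].
have {}FA : <<s G >> A.
  apply: sub_sigma_algebra2 FA => _ [s [y [s0 st ->]]].
  exists [:: (s, y)]; first by move=> q; rewrite inE => /eqP ->; rewrite s0.
  apply/seteqP; split=> [w Bs q|w H]; first by rewrite inE => /eqP ->.
  by apply: (H (s, y)); rewrite mem_head.
have k0 : 0 <= gibbs a x (bottom_row x) by exact: gibbs_ge0.
have mU : measurable [set w | B t w = bottom_row x] by exact: measurable_bottom_row.
have mX : measurable [set w | Z t w = x] by exact: mZ.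
have cyl0 : cylinder [::] = setT by apply/seteqP; split.
apply: (@g_sigma_algebra_measure_unique _ R T G _ (fun=> setT) _ _
  (mrestr P mX) (mscale (NngNum k0) (mrestr P mU))) => //.
- by move=> _ [l lt ->]; apply: measurable_cylinder => q /lt /ge0.
- by move=> _; exists [::].
- by rewrite bigcup_const //; exists 0%N.
- move=> _ _ [l lt ->] [l' lt' ->]; exists (l ++ l').
    by move=> q; rewrite mem_cat => /orP[/lt|/lt'].
  apply/seteqP; split=> [w [H H'] q|w H].
    by rewrite mem_cat => /orP[/H|/H'].
  by split=> q ql; apply: H; rewrite mem_cat ql ?orbT.
- move=> _ [l lt ->]; exact: cylinder_law.
- move=> _; rewrite /= /mrestr (le_lt_trans (probability_le1 _ _)) ?ltry //.
  exact: measurableI.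
Qed.

(** As a function of the sample point, the Gibbs mass of [x] is a constant times
    the indicator of the event that the bottom row at time [t] is that of [x]. *)
Lemma bottom_row_conditional_law t : 0 <= t ->
  conditional_law P (past (fun s w => B s w) t) (Z t)
    (fun w x => gibbs a x (B t w)).
Proof.
move=> t0 x; set y := bottom_row x; set U := [set w | B t w = y].
have FU : past (fun s w => B s w) t U.
  by apply: sub_sigma_algebra; exists t, y; split.
have nuE : (fun w => gibbs a x (B t w)) = (fun w => gibbs a x y * \1_U w).
  apply/funext => w; rewrite indicE; have [Bt|Bt] := eqVneq (B t w) y.
    by rewrite mem_set // Bt mulr1.
  rewrite memNset; last by move=> /= e; rewrite e eqxx in Bt.
  by rewrite mulr0 /gibbs eq_sym (negbTE Bt).
have mU : measurable U by exact: measurable_bottom_row.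
split.
  move=> C _; have -> : (fun w => gibbs a x (B t w)) @^-1` C =
     (U `&` [set w | C (gibbs a x y)]) `|` (~` U `&` [set w | C 0]).
    rewrite nuE; apply/seteqP; split=> [w|w [[Uw]|[Uw]]] /=.
    - have [Uw|Uw] := pselect (U w).
        by rewrite indicE mem_set // mulr1; left.
      by rewrite indicE memNset // mulr0; right.
    - by rewrite indicE mem_set // mulr1.
    - by rewrite indicE memNset // mulr0.
  have FC : past (fun s w => B s w) t (~` U).
    by rewrite -setTD; exact: sigma_algebraCD.
  have cst (Q : Prop) : [set w : T | Q] = setT \/ [set w : T | Q] = set0.
    have [q|q] := pselect Q; [left|right]; apply/seteqP; split=> //.
  have FT : past (fun s w => B s w) t setT.
    by rewrite -(setD0 setT); apply: sigma_algebraCD; exact: sigma_algebra0.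
  have F0 : past (fun s w => B s w) t set0 by exact: sigma_algebra0.
  have [->|->] := cst (C (gibbs a x y)); have [->|->] := cst (C 0);
    by rewrite ?setIT ?setI0 ?setU0 ?set0U ?setUv.
move=> A FA; have [mA ->] := past_law x t0 FA.
rewrite (_ : (fun w => (gibbs a x (B t w))%:E) = (fun w => (gibbs a x y * \1_U w)%:E)); last first.
  by apply/funext => w; rewrite -[gibbs a x (B t w)]/((fun w => gibbs a x (B t w)) w) nuE.
rewrite (@integralZl_indic _ _ _ P _ mA (fun=> U)) //.
  by rewrite integral_indic // setIC.
by move=> k0; have := gibbs_ge0 a_gt0 x y; rewrite leNgt k0.
Qed.

Lemma bottom_row_markov :
  {ae P, forall w, forall t : R, 0 <= t -> \forall s \near t^'+, Z s w = Z t w} ->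
  markov_process P (fun t w => B t w) (fun y => (y == z)%:R) (weyl_rate a).
Proof.
move=> right_cont; split.
- by move=> t y t0; exact: measurable_bottom_row.
- apply: filterS right_cont => w H t t0; have := H t t0.
  by apply: filterS => s ->.
exists pbar; split.
- exact: (projected_transition a_gt0 tp rate_p).
- exact: (projected_rate a_gt0 tp rate_p).
by move=> m t y t0 tm; rewrite path_law.
Qed.
End BottomRowProcess.

Theorem theorem4p2p3 (R : realType) (n : nat) (a : 'I_n -> R) (z : weyl n)
    (d : measure_display) (T : measurableType d) (P : probability T R)
    (Z : R -> T -> pattern n) :
  (1 <= n)%N ->
  (forall i, 0 < a i) ->
  markov_process P Z (fun x => gibbs a x z) (berele_rate a) ->
  markov_process P (fun t w => bottom_row (Z t w)) (fun y => (y == z)%:R)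
    (weyl_rate a) /\
  (forall t : R, 0 < t ->
    conditional_law P (past (fun s w => bottom_row (Z s w)) t) (Z t)
      (fun w x => gibbs a x (bottom_row (Z t w)))).
Proof.
move=> _ a_gt0 [mZ cZ [p [tp rp fdd]]]; split.
  exact: (bottom_row_markov a_gt0 mZ tp rp fdd cZ).
by move=> t t0; apply: (bottom_row_conditional_law a_gt0 mZ tp rp fdd); exact: ltW.
Qed.
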